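(* Let $k$ be an algebraically closed field of characteristic zero or greater than $4$. (a) There are infinitely many isomorphism types of local Artinian Gorenstein $k$-algebras with Hilbert function $(1,3,4,3,1)$. (b) Let $P=k_{dp}[x,y,z]$ and let $F\in P_4$ be a quartic form such that $\operatorname{Apolar}(F)$ has Hilbert function $(1,3,4,3,1)$. Then $F+P_{\le 3}\subset \mathbb G\cdot F$ if and only if no square $\ell^2$ of a non-zero linear form $\ell\in\langle\alpha,\beta,\gamma\rangle$ annihilates $F$.
   Context: Let $S=k[[\alpha,\beta,\gamma]]$ with maximal ideal $\mathfrak m$. $P=k_{dp}[x,y,z]$ is the divided power ring, with $k$-basis the monomials $\mathbf x^{[\mathbf a]}$, $\mathbf a\in\mathbb N_0^3$ (of degree $\sum a_i$); $P_4$ and $P_{\le 3}$ are the spans of those of degree $4$, resp. at most $3$. $P$ is identified with the space of $k$-linear functionals on $S$ vanishing on some power of $\mathfrak m$, with $\mathbf x^{[\mathbf a]}$ dual to the monomial with exponent $\mathbf a$; the pairing is denoted $\langle-,-\rangle:S\times P\to k$. $S$ acts on $P$ by contraction, $\langle\tau,\sigma\lrcorner f\rangle=\langle\tau\sigma,f\rangle$. $\operatorname{Apolar}(f)=S/\{\sigma\in S:\sigma\lrcorner f=0\}$. An automorphism $\varphi$ of the $k$-algebra $S$ acts on $P$ through its dual map $\varphi^\vee$, $\langle\sigma,\varphi^\vee(f)\rangle=\langle\varphi(\sigma),f\rangle$. $\mathbb G=\operatorname{Aut}(S)\ltimes S^*$ is the group of linear operators on $S$ generated by the automorphisms and by multiplications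 by invertible elements; it acts on $P$ by dual maps, and $\mathbb G\cdot F$ is the orbit of $F$ (two elements $f,g\in P$ lie in the same $\mathbb G$-orbit iff $\operatorname{Apolar}(f)\simeq\operatorname{Apolar}(g)$). The Hilbert function of a local algebra $A$ (with residue field $k$) is $H_A(i)=\dim_k\mathfrak m_A^i/\mathfrak m_A^{i+1}$. *)

(* Defs.v *)
From HB Require Import structures.
From mathcomp Require Import all_boot all_algebra.
From mathcomp Require Import generic_quotient ring_quotient boolp.
From mathcomp Require Import ssrcomplements mpoly.

Set Implicit Arguments.
Unset Strict Implicit.
Unset Printing Implicit Defensive.

Import GRing.Theory.

Local Open Scope ring_scope.
Local Open Scope quotient_scope.

(** Formal power series in [n] variables. *)

Record fpseries (n : nat) (R : Type) := FPSeries { fpcoef :> 'X_{1..n} -> R }.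

HB.instance Definition _ (n : nat) (R : Type) := gen_eqMixin (fpseries n R).
HB.instance Definition _ (n : nat) (R : Type) := gen_choiceMixin (fpseries n R).

Section PowerSeries.
Variables (n : nat) (R : comNzRingType).
Implicit Types (s t u : fpseries n R) (m : 'X_{1..n}).

Lemma fpseriesP s t : (forall m, s m = t m) -> s = t.
Proof. by case: s t => [s] [t] /= /funext ->. Qed.

Definition fps0 := FPSeries (fun _ : 'X_{1..n} => 0 : R).
Definition fps_opp s := FPSeries (fun m => - s m).
Definition fps_add s t := FPSeries (fun m => s m + t m).
Definition fps1 := FPSeries (fun m : 'X_{1..n} => (m == 0%MM)%:R : R).
Definition fps_mul s t := FPSeries (fun m =>
  \sum_(h : 'X_{1..n < (mdeg m).+1, (mdeg m).+1} | m == (h.1 + h.2)%MM)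
     s h.1 * t h.2).
Definition fps_scale (c : R) s := FPSeries (fun m => c * s m).

Fact fps_addA : associative fps_add.
Proof. by move=> s t u; apply: fpseriesP => m /=; rewrite addrA. Qed.
Fact fps_addC : commutative fps_add.
Proof. by move=> s t; apply: fpseriesP => m /=; rewrite addrC. Qed.
Fact fps_add0 : left_id fps0 fps_add.
Proof. by move=> s; apply: fpseriesP => m /=; rewrite add0r. Qed.
Fact fps_addN : left_inverse fps0 fps_opp fps_add.
Proof. by move=> s; apply: fpseriesP => m /=; rewrite addNr. Qed.

HB.instance Definition _ := GRing.isZmodule.Build (fpseries n R)
  fps_addA fps_addC fps_add0 fps_addN.

(* The ring axioms are inherited from polynomials: below degree [d], a product
   of series is the product of the truncations. *)
Definition fps_trunc (d : nat) s : {mpoly R[n]} :=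
  \sum_(h : 'X_{1..n < d}) s h *: 'X_[h].

Lemma fps_truncE d s m : (mdeg m < d)%N -> (fps_trunc d s)@_m = s m.
Proof.
move=> ltmd; rewrite raddf_sum /= (bigD1 (BMultinom ltmd)) //= mcoeffZ mcoeffX.
rewrite eqxx mulr1 big1 ?addr0 // => h; rewrite bmeqP /= => /negPf neq.
by rewrite mcoeffZ mcoeffX neq mulr0.
Qed.

Lemma fps_mul_trunc d s t m : (mdeg m < d)%N ->
  fps_mul s t m = (fps_trunc d s * fps_trunc d t)@_m.
Proof.
move=> ltmd; rewrite mcoeffM; apply: eq_bigr => h _.
by rewrite !fps_truncE ?(leq_trans (bmdeg _)).
Qed.

Lemma mcoeffM_low (p q p' q' : {mpoly R[n]}) m :
    (forall h, (mdeg h <= mdeg m)%N -> p@_h = p'@_h) ->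
    (forall h, (mdeg h <= mdeg m)%N -> q@_h = q'@_h) ->
  (p * q)@_m = (p' * q')@_m.
Proof.
move=> eqp eqq; rewrite !mcoeffM; apply: eq_bigr => h _.
by rewrite eqp ?eqq // -ltnS bmdeg.
Qed.

Fact fps_mulA : associative fps_mul.
Proof.
move=> s t u; apply: fpseriesP => m; rewrite !(@fps_mul_trunc (mdeg m).+1) //.
transitivity (fps_trunc (mdeg m).+1 s *
  (fps_trunc (mdeg m).+1 t * fps_trunc (mdeg m).+1 u))@_m.
  apply: mcoeffM_low => // h leh.
  by rewrite fps_truncE ?ltnS // (@fps_mul_trunc (mdeg m).+1).
rewrite mulrA; apply: mcoeffM_low => // h leh.
by rewrite fps_truncE ?ltnS // (@fps_mul_trunc (mdeg m).+1).
Qed.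

Fact fps_mulC : commutative fps_mul.
Proof.
move=> s t; apply: fpseriesP => m.
by rewrite !(@fps_mul_trunc (mdeg m).+1) // mulrC.
Qed.

Fact fps_mul1 : left_id fps1 fps_mul.
Proof.
move=> s; apply: fpseriesP => m; rewrite (@fps_mul_trunc (mdeg m).+1) //.
rewrite -[RHS](@fps_truncE (mdeg m).+1) // -[in RHS](mul1r (fps_trunc _ s)).
apply: mcoeffM_low => // h leh.
by rewrite fps_truncE ?ltnS // mcoeff1.
Qed.

Fact fps_mulDl : left_distributive fps_mul +%R.
Proof.
move=> s t u; apply: fpseriesP => m /=; rewrite -big_split /=.
by apply: eq_bigr => h _; rewrite mulrDl.
Qed.

Fact fps1_neq0 : fps1 != 0.
Proof.
apply/eqP => /(congr1 (fun s : fpseries n R => s 0%MM)) /eqP /=.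
by rewrite eqxx oner_eq0.
Qed.

HB.instance Definition _ := GRing.Zmodule_isComNzRing.Build (fpseries n R)
  fps_mulA fps_mulC fps_mul1 fps_mulDl fps1_neq0.

Fact fps_scaleA a b s : fps_scale a (fps_scale b s) = fps_scale (a * b) s.
Proof. by apply: fpseriesP => m /=; rewrite mulrA. Qed.
Fact fps_scale1 : left_id 1 fps_scale.
Proof. by move=> s; apply: fpseriesP => m /=; rewrite mul1r. Qed.
Fact fps_scaleDr : right_distributive fps_scale +%R.
Proof. by move=> a s t; apply: fpseriesP => m /=; rewrite mulrDr. Qed.
Fact fps_scaleDl s : {morph fps_scale^~ s : a b / a + b}.
Proof. by move=> a b; apply: fpseriesP => m /=; rewrite mulrDl. Qed.

HB.instance Definition _ := GRing.Zmodule_isLmodule.Build R (fpseries n R)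
  fps_scaleA fps_scale1 fps_scaleDr fps_scaleDl.

Fact fps_scaleAl (a : R) s t : a *: (s * t) = (a *: s) * t.
Proof.
apply: fpseriesP => m /=; rewrite mulr_sumr.
by apply: eq_bigr => h _; rewrite mulrA.
Qed.

HB.instance Definition _ := GRing.Lmodule_isLalgebra.Build R (fpseries n R)
  fps_scaleAl.
HB.instance Definition _ := GRing.Lalgebra_isComAlgebra.Build R (fpseries n R).

Definition fpsXm (m : 'X_{1..n}) : fpseries n R :=
  FPSeries (fun h => (h == m)%:R).

Definition linear_form (c : 'rV[R]_n) : fpseries n R :=
  \sum_(i < n) c 0 i *: fpsXm U_(i)%MM.

End PowerSeries.

(** Contraction. *)

(* The divided power ring as a k-space: ['X_[a]] stands for the divided power
   monomial x^[a]. Only the linear structure of [{mpoly k[n]}] is kept, since its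
   product is not the divided power product; [msize] (1 + degree), [d.-homog]
   and coefficients have their usual meaning. *)
Definition dpspace (n : nat) (k : fieldType) := {mpoly k[n]}.
HB.instance Definition _ (n : nat) (k : fieldType) :=
  GRing.Lmodule.on (dpspace n k).

Section Contraction.
Variables (n : nat) (k : fieldType).
Implicit Types (s t : fpseries n k) (f g : dpspace n k).

Definition pairing s f : k := \sum_(m <- msupp f) s m * f@_m.

Definition contract s f : dpspace n k :=
  \sum_(m <- msupp f)
    \sum_(a : 'X_{1..n < (mdeg m).+1} | (a <= m)%MM)
       (s a * f@_m) *: 'X_[m - a].

Lemma pairingwE d s f : (msize f <= d)%N ->
  pairing s f = \sum_(m : 'X_{1..n < d}) s m * f@_m.
Proof.
move=> led; pose I : subFinType _ := 'X_{1..n < d}.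
rewrite /pairing (big_mksub I) ?msupp_uniq //=; last first.
  by move=> m /msize_mdeg_lt /leq_trans; apply.
by rewrite big_rmcond //= => m /memN_msupp_eq0 ->; rewrite mulr0.
Qed.

Lemma pairing_linear s : scalar (pairing s).
Proof.
move=> c f g; pose d := maxn (msize (c *: f + g)) (maxn (msize f) (msize g)).
rewrite !(@pairingwE d) ?leq_max ?leqnn ?orbT // mulr_sumr -big_split /=.
by apply: eq_bigr => m _; rewrite mcoeffD mcoeffZ mulrDr mulrCA.
Qed.

HB.instance Definition _ s :=
  GRing.isLinear.Build k (dpspace n k) k *%R (pairing s) (pairing_linear s).

Lemma pairingX s m : pairing s 'X_[m] = s m.
Proof. by rewrite /pairing msuppX big_seq1 mcoeffX eqxx mulr1. Qed.

Lemma pairing_Xm m f : pairing (fpsXm k m) f = f@_m.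
Proof.
rewrite {2}[f]mpolyE raddf_sum /=; apply: eq_bigr => h _.
by rewrite mcoeffZ mcoeffX mulrC.
Qed.

Lemma pairingDl s t f : pairing (s + t) f = pairing s f + pairing t f.
Proof.
by rewrite /pairing -big_split; apply: eq_bigr => m _; rewrite /= mulrDl.
Qed.

Lemma pairing0l f : pairing 0 f = 0.
Proof. by rewrite /pairing big1 // => m _; rewrite mul0r. Qed.

Lemma pairing_contract t s f : pairing t (contract s f) = pairing (t * s) f.
Proof.
rewrite /contract linear_sum [t * s]mulrC; apply: eq_bigr => m _.
rewrite linear_sum -[(s * t) m]/(fps_mul s t m).
rewrite (@fps_mul_trunc _ _ (mdeg m).+1) //.
rewrite (@mcoeff_poly_mul_lin _ _ _ _ _ (mdeg m).+1) // mulr_suml.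
apply: eq_bigr => a lea; rewrite linearZ /= pairingX.
rewrite !fps_truncE ?bmdeg // 1?ltnS ?(leq_trans (mdegB _ _)) //.
by rewrite mulrAC.
Qed.

Definition annihilator f : {pred fpseries n k} :=
  [pred s | contract s f == 0].

Lemma annihilatorP s f :
  reflect (forall t, pairing (t * s) f = 0) (s \in annihilator f).
Proof.
rewrite inE; apply: (iffP eqP) => [s0 t | ann].
  by rewrite -pairing_contract s0 linear0.
by apply/mpolyP => m; rewrite -pairing_Xm pairing_contract ann mcoeff0.
Qed.

Lemma annihilator_idealr f : f != 0 -> idealr_closed (annihilator f).
Proof.
move=> f0; split.
- by apply/annihilatorP => t; rewrite mulr0 pairing0l.
- apply: contra f0 => /annihilatorP ann1; apply/eqP/mpolyP => m.
  by rewrite -pairing_Xm -[fpsXm _ _]mulr1 ann1 mcoeff0.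
move=> a s t /annihilatorP anns /annihilatorP annt; apply/annihilatorP => u.
by rewrite mulrDr pairingDl annt addr0 mulrA anns.
Qed.

End Contraction.

(** The quotient of a commutative algebra by a proper ideal, as an algebra. *)

Section QuotientAlgebra.
Variables (k : fieldType) (A : comAlgType k) (I : idealr A).

Definition quot_alg := {ideal_quot I}.
HB.instance Definition _ := GRing.ComNzRing.on quot_alg.

Definition quot_scale (c : k) (x : quot_alg) : quot_alg :=
  \pi_{ideal_quot I} c%:A * x.

Fact quot_scaleA a b x : quot_scale a (quot_scale b x) = quot_scale (a * b) x.
Proof. by rewrite /quot_scale mulrA -rmorphM -scalerAl mul1r scalerA. Qed.
Fact quot_scale1 : left_id 1 quot_scale.
Proof. by move=> x; rewrite /quot_scale scale1r rmorph1 mul1r. Qed.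
Fact quot_scaleDr : right_distributive quot_scale +%R.
Proof. by move=> a x y; rewrite /quot_scale mulrDr. Qed.
Fact quot_scaleDl x : {morph quot_scale^~ x : a b / a + b}.
Proof. by move=> a b; rewrite /quot_scale scalerDl rmorphD mulrDl. Qed.

HB.instance Definition _ := GRing.Zmodule_isLmodule.Build k quot_alg
  quot_scaleA quot_scale1 quot_scaleDr quot_scaleDl.

Fact quot_scaleAl (a : k) (x y : quot_alg) : a *: (x * y) = (a *: x) * y.
Proof. exact: mulrA. Qed.

HB.instance Definition _ := GRing.Lmodule_isLalgebra.Build k quot_alg
  quot_scaleAl.
HB.instance Definition _ := GRing.Lalgebra_isComAlgebra.Build k quot_alg.

End QuotientAlgebra.

Definition annihilator_ideal (n : nat) (k : fieldType) (f : dpspace n k)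
    (f0 : f != 0) : idealr (fpseries n k) :=
  HB.pack (annihilator f : fpseries n k -> bool)
    (isIdealr.Build (fpseries n k) (annihilator f) (annihilator_idealr f0)).

(* The zero ring is not a [comAlgType], hence [f0]: [Apolar 0] would be zero. *)
Definition Apolar (n : nat) (k : fieldType) (f : dpspace n k) (f0 : f != 0) :
  comAlgType k := quot_alg (annihilator_ideal f0).

(** The group generated by the automorphisms of k[[x_1, ..., x_n]] and the
    multiplications by units, and its orbits. *)

Section Orbits.
Variables (n : nat) (k : fieldType).
Local Notation S := (fpseries n k).

Inductive in_G : (S -> S) -> Prop :=
| in_G_aut (phi : {lrmorphism S -> S}) : bijective phi -> in_G phi
| in_G_unit (u v : S) : v * u = 1 -> in_G (fun s => u * s)
| in_G_comp (phi psi : S -> S) : in_G phi -> in_G psi -> in_G (phi \o psi)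
| in_G_inv (phi psi : S -> S) :
    in_G phi -> cancel phi psi -> cancel psi phi -> in_G psi.

(* [g] is the image of [f] under the dual map of [phi]. *)
Definition is_dual_image (phi : S -> S) (f g : dpspace n k) :=
  forall s, pairing s g = pairing (phi s) f.

(* [g] belongs to the orbit of [f]. *)
Definition G_orbit (f g : dpspace n k) :=
  exists2 phi, in_G phi & is_dual_image phi f g.

End Orbits.

(** Local Artinian Gorenstein algebras. *)

Section LocalAlgebras.
Variables (k : fieldType) (A : comAlgType k).
Implicit Types (I J m : {pred A}).

(* [idealr_closed] only covers proper ideals. *)
Definition maximal_ideal m :=
  idealr_closed m /\
  forall I, idealr_closed I -> {subset m <= I} -> I =i m.

Definition local_with m :=
  maximal_ideal m /\ forall m', maximal_ideal m' -> m' =i m.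

(* The map k -> A / m is onto, hence bijective. *)
Definition residue_field_is_base m :=
  forall a : A, exists c : k, a - c%:A \in m.

(* Descending chain condition; a chain of proper ideals loses nothing, as the
   unit ideal can only occur at the start of a descending chain. *)
Definition artinian :=
  forall I : nat -> {pred A},
    (forall i, idealr_closed (I i)) ->
    (forall i, {subset I i.+1 <= I i}) ->
  exists N, forall i, (N <= i)%N -> I i =i I N.

Definition ideal_mul I J : {pred A} :=
  [pred x | `[< exists (r : nat) (a b : 'I_r -> A),
     (forall j, a j \in I /\ b j \in J) /\ x = \sum_(j < r) a j * b j >]].

Definition ideal_exp m (i : nat) : {pred A} := iter i (ideal_mul m) predT.

(* The k-dimension of V / W is d, for subspaces W of V: some d-tuple of elements
   of V is a basis modulo W. *)
Definition quotient_dim (V W : {pred A}) (d : nat) :=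
  exists e : 'I_d -> A, (forall j, e j \in V) /\
    forall v, v \in V ->
      exists! c : 'rV[k]_d, v - \sum_(j < d) c 0 j *: e j \in W.

(* The annihilator of m. *)
Definition alg_socle m : {pred A} :=
  [pred a | `[< forall b, b \in m -> b * a = 0 >]].

(* One-dimensional over k, which is the residue field wherever this is used. *)
Definition gorenstein_with m := quotient_dim (alg_socle m) (pred1 0) 1.

Definition local_artinian_gorenstein :=
  exists m, [/\ local_with m, residue_field_is_base m, artinian
              & gorenstein_with m].

Definition has_hilbert_function (H : nat -> nat) :=
  exists m, [/\ local_with m, residue_field_is_base m
    & forall i, quotient_dim (ideal_exp m i) (ideal_exp m i.+1) (H i)].

End LocalAlgebras.

Definition alg_isomorphic (k : fieldType) (A B : comAlgType k) :=
  exists phi : {lrmorphism A -> B}, bijective phi.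

Arguments local_artinian_gorenstein {k} A.
Arguments has_hilbert_function {k} A H.

(* Main.v *)
Require Import Defs.
From HB Require Import structures.
From mathcomp Require Import all_boot all_algebra.
From mathcomp Require Import generic_quotient ring_quotient boolp ssrcomplements.
From mathcomp Require Import mpoly ring zify.

(** (b) An automorphism with alpha_i |-> alpha_i + D_i, where all D_i have degree
    5 - d, changes F only in degrees at most d, and in degree d by the functional
    p |-> sum_i <(d_i p) D_i, F>. By duality, every form of degree d is obtained in
    this way unless some nonzero form of degree d has all its partial derivatives
    in Ann(F). For d = 1, 2 this is excluded by H(1) = 3; for d = 0 a unit is used.
    For d = 3 the partials of such a cubic lie in Ann(F)_2, which has dimension
    6 - H(2) = 2, so they are linearly dependent and the cubic is binary; at a zero
    of its Hessian the polar quadric is the square of a linear form, and it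
    annihilates F. Conversely, if l^2 annihilates F, then every C with F + C in the
    orbit of F is orthogonal to l^3, by comparing leading forms.

    (a) For F = x^[4] + y^[4] + y z^[3] + lam z^[4] an isomorphism of apolar
    algebras preserves the multiplication (m/m^2)^4 -> m^4 up to a scalar, that is,
    the quartic F up to linear equivalence. It therefore preserves the splitting of
    F into x^[4] and a binary quartic, and lam^3 is the absolute invariant
    I^3 / J^2 of the latter. *)

Set Implicit Arguments.
Unset Strict Implicit.
Unset Printing Implicit Defensive.

Import GRing.Theory.
Local Open Scope ring_scope.
Local Open Scope quotient_scope.

Arguments fps_mul : simpl never.
Arguments fps_add : simpl never.
Arguments fps_opp : simpl never.
Arguments fps_scale : simpl never.

(** * Power series and the order filtration *)

(** The conditions on the D_i form finite linear systems, and the Fredholm alternative turns an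
    obstruction into a solution of the transposed homogeneous system. For d = 3 that solution is a
    tensor, and only its symmetrization is the cubic in question; comparing the two costs a factor
    6. The degrees are treated downwards from 3, because a step disturbs the remaining terms only
    below the degree that it removes. The Hessian of a binary cubic is the determinant of its polar
    quadric, so at a zero the rank is at most 1. If the polar quadric vanishes there altogether, the
    cubic is a multiple of a cube, and another direction yields the square. In (a), I and J have
    degrees 2, 3 and weights 4, 6, so the scalar of m^4 and the determinant of the substitution both
    cancel in I^3 / J^2. An infinite field provides infinitely many values of lam^3. *)

Section OrderFiltration.
Variables (n : nat) (k : fieldType).
Implicit Types (s t u : fpseries n k) (m h : 'X_{1..n}) (d e : nat).

Definition ord_ge d s := forall m, (mdeg m < d)%N -> s m = 0.

Lemma ord_geD d s t : ord_ge d s -> ord_ge d t -> ord_ge d (s + t).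
Proof.
move=> os ot m lt; change (s m + t m = 0).
by rewrite os // ot // addr0.
Qed.

Lemma ord_geN d s : ord_ge d s -> ord_ge d (- s).
Proof. by move=> os m lt; change (- s m = 0); rewrite os // oppr0. Qed.

Lemma ord_geB d s t : ord_ge d s -> ord_ge d t -> ord_ge d (s - t).
Proof. by move=> os ot; apply/ord_geD/ord_geN. Qed.

Lemma ord_geZ d (c : k) s : ord_ge d s -> ord_ge d (c *: s).
Proof. by move=> os m lt; change (c * s m = 0); rewrite os // mulr0. Qed.

Lemma ord_ge_sum d (I : Type) (r : seq I) (P : pred I) (f : I -> fpseries n k) :
  (forall i, P i -> ord_ge d (f i)) -> ord_ge d (\sum_(i <- r | P i) f i).
Proof. by move=> of_; elim/big_ind: _ => //; apply: ord_geD. Qed.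

Lemma ord_geW e d s : (d <= e)%N -> ord_ge e s -> ord_ge d s.
Proof. by move=> le os m lt; apply: os; apply: leq_trans le. Qed.

Lemma ord_geM d e s t : ord_ge d s -> ord_ge e t -> ord_ge (d + e) (s * t).
Proof.
move=> os ot m lt; apply: big1 => h /eqP em.
case: (ltnP (mdeg h.1) d) => [/os -> | le1]; first by rewrite mul0r.
have := congr1 mdeg em; rewrite mdegD => edeg.
rewrite (ot h.2) ?mulr0 // -(ltn_add2l (mdeg h.1)) -edeg.
by rewrite (leq_trans lt) // leq_add2r.
Qed.

Lemma ord_geMl d s t : ord_ge d t -> ord_ge d (s * t).
Proof. exact: (@ord_geM 0). Qed.

Lemma ord_geMr d s t : ord_ge d s -> ord_ge d (s * t).
Proof. by rewrite mulrC; apply: ord_geMl. Qed.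

Lemma ord_geX d s : ord_ge 1 s -> ord_ge d (s ^+ d).
Proof.
move=> os; elim: d => // d IH.
by rewrite exprS; apply: (@ord_geM 1).
Qed.

Lemma ord_ge_Xm m : ord_ge (mdeg m) (fpsXm k m).
Proof. by move=> h lt /=; case: eqP => // eh; move: lt; rewrite eh ltnn. Qed.

Lemma ord_ge_eq0 s : (forall d, ord_ge d s) -> s = 0.
Proof. by move=> os; apply: fpseriesP => m; apply: (os (mdeg m).+1). Qed.

Lemma fpsD_coef s t m : (s + t) m = s m + t m. Proof. by []. Qed.
Lemma fpsN_coef s m : (- s) m = - s m. Proof. by []. Qed.
Lemma fpsZ_coef (c : k) s m : (c *: s) m = c * s m. Proof. by []. Qed.
Lemma fps1_coef m : (1 : fpseries n k) m = (m == 0%MM)%:R. Proof. by []. Qed.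
Lemma fpsXm_coef h m : fpsXm k h m = (m == h)%:R. Proof. by []. Qed.

Lemma fps_sum_coef (I : Type) (r : seq I) (P : pred I) (f : I -> fpseries n k) m :
  (\sum_(i <- r | P i) f i) m = \sum_(i <- r | P i) f i m.
Proof. by elim/big_rec2: _ => // i x y _ <-. Qed.

Lemma coef_XmM h t m :
  (fpsXm k h * t) m = if (h <= m)%MM then t (m - h)%MM else 0.
Proof.
change (fps_mul (fpsXm k h) t m = if (h <= m)%MM then t (m - h)%MM else 0).
rewrite (@fps_mul_trunc _ _ (mdeg m).+1) //.
rewrite (@mcoeff_poly_mul_lin _ _ _ _ _ (mdeg m).+1) //.
case: ifPn => [le | nle].
  have lt : (mdeg h < (mdeg m).+1)%N by rewrite ltnS -(submK le) mdegD leq_addl.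
  rewrite (bigD1 (BMultinom lt)) //= fps_truncE //= fps_truncE ?ltnS ?mdegB //.
  rewrite eqxx mul1r big1 ?addr0 // => a /andP[_ ne].
  rewrite fps_truncE ?bmdeg //= -[_ == h]/(val a == val (BMultinom lt)).
  by rewrite val_eqE (negPf ne) mul0r.
rewrite big1 // => a le; rewrite fps_truncE ?bmdeg //=.
case: eqP => [e|]; rewrite ?mul0r //.
by move: le nle; rewrite e => ->.
Qed.

Lemma fpsXmD m h : fpsXm k (m + h)%MM = fpsXm k m * fpsXm k h.
Proof.
apply: fpseriesP => a; rewrite coef_XmM /=; case: ifPn => [le | nle].
  congr (_%:R); rewrite -{1}(submK le) [(_ + m)%MM]addmC.
  by congr nat_of_bool; apply/eqP/eqP => [/addmI|->].
by case: eqP => // e; rewrite e lem_addr in nle.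
Qed.

Lemma coef_linM i t m :
  (fpsXm k U_(i)%MM * t) m = if (0 < m i)%N then t (m - U_(i))%MM else 0.
Proof. by rewrite coef_XmM lep1mP lt0n. Qed.


(* Each monomial other than 1 is divided by the first variable occurring in it. *)
Lemma ord_geS_split d s : ord_ge d.+1 s ->
  exists2 t : 'I_n -> fpseries n k, forall i, ord_ge d (t i)
    & s = \sum_i fpsXm k U_(i)%MM * t i.
Proof.
move=> os; pose first (i : 'I_n) (m : 'X_{1..n}) :=
  [forall j : 'I_n, (j < i)%N ==> (m j == 0%N)].
exists (fun i => FPSeries (fun m => if first i m then s (m + U_(i))%MM else 0)).
  move=> i m lt /=; case: ifP => // _; apply: os.
  by rewrite mdegD mdeg1 addn1.
apply: fpseriesP => m; rewrite fps_sum_coef.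
have [-> | nz] := eqVneq m 0%MM.
  rewrite os ?mdeg0 // big1 // => i _.
  by rewrite coef_linM mnm0E.
have /existsP[i0 nz0] : [exists i : 'I_n, m i != 0%N].
  apply: contraNT nz; rewrite negb_exists => /forallP H.
  by apply/eqP/mnmP => i; rewrite mnm0E; move/negPn/eqP: (H i).
case: (@arg_minnP _ i0 (fun i => m i != 0%N) val nz0) => i nzi mini.
rewrite (bigD1 i) // big1 ?addr0 => [|j ne].
  rewrite coef_linM lt0n nzi /= ifT ?addr0 ?submK ?lep1mP //.
  apply/forallP => j; apply/implyP => ltj; rewrite mnmBE mnm1E.
  by apply: contraTT ltj; rewrite subn_eq0 -leqNgt => nzj; apply: mini; lia.
rewrite coef_linM; case: posnP => //= /lt0n_neq0 nzj.
rewrite ifF //; apply/negbTE; rewrite negb_forall; apply/existsP; exists i.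
rewrite negb_imply mnmBE mnm1E (negPf ne) subn0 nzi andbT.
by rewrite ltn_neqAle mini // andbT eq_sym.
Qed.

Lemma ord_ge1P s : ord_ge 1 s <-> s 0%MM = 0.
Proof.
split=> [os | s0 m]; first by apply: os; rewrite mdeg0.
by rewrite ltnS leqn0 mdeg_eq0 => /eqP ->.
Qed.

Lemma ord_ge_const s : ord_ge 1 (s - (s 0%MM)%:A).
Proof.
by apply/ord_ge1P; rewrite fpsD_coef fpsN_coef fpsZ_coef fps1_coef eqxx mulr1 subrr.
Qed.

Definition linear_part s : 'rV[k]_n := \row_i s U_(i)%MM.

Lemma coef_linear_form (c : 'rV[k]_n) m :
  linear_form c m = \sum_i c 0 i * (m == U_(i)%MM)%:R.
Proof. by rewrite fps_sum_coef. Qed.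

Lemma linear_formU (c : 'rV[k]_n) i : linear_form c U_(i)%MM = c 0 i.
Proof.
rewrite coef_linear_form (bigD1 i) //= eqxx mulr1 big1 ?addr0 // => j ne.
by rewrite eq_mnm1 eq_sym (negPf ne) mulr0.
Qed.

Lemma ord_ge_linear_form (c : 'rV[k]_n) : ord_ge 1 (linear_form c).
Proof.
by apply: ord_ge_sum => i _; apply: ord_geZ; rewrite -(mdeg1 i); apply: ord_ge_Xm.
Qed.

Lemma ord_ge_linear_part s :
  ord_ge 1 s -> ord_ge 2 (s - linear_form (linear_part s)).
Proof.
move=> os m lt; rewrite fpsD_coef fpsN_coef.
have [lt1 | ] := ltnP (mdeg m) 1.
  by rewrite os // ord_ge_linear_form // subrr.
rewrite leq_eqVlt ltnNge -ltnS lt orbF eq_sym => /mdeg1P[i /eqP ->].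
by rewrite linear_formU mxE subrr.
Qed.

Definition raises_order (phi : fpseries n k -> fpseries n k) :=
  forall d s, ord_ge d s -> ord_ge d.+1 (phi s - s).

(* The inverse is the limit of [s <- t - (phi s - s)]. *)
Lemma raises_order_surj (phi : {additive fpseries n k -> fpseries n k}) :
  raises_order phi -> forall t, exists s, phi s = t.
Proof.
move=> ro t; have [st E] : exists st : nat -> fpseries n k,
    forall j, st j.+1 = st j - (phi (st j) - t).
  by exists (fun j => iter j (fun s => s - (phi s - t)) 0).
have step j : ord_ge j (st j.+1 - st j).
  elim: j => // j IH.
  have -> : st j.+2 - st j.+1 = - (phi (st j.+1 - st j) - (st j.+1 - st j)).
    rewrite (raddfB phi) (E j.+1); set a := phi (st j.+1).
    by rewrite [in RHS](E j); set b := phi (st j); ring.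
  by apply/ord_geN/ro.
have far j i : ord_ge j (st (i + j)%N - st j).
  elim: i => [|i IH]; first by rewrite subrr.
  rewrite -[X in ord_ge _ X](subrKA (st (i + j)%N)).
  apply: ord_geD IH; apply: (@ord_geW (i + j)); first exact: leq_addl.
  exact: step.
(* The coefficient of [m] no longer changes from index [mdeg m + 1] on, so the diagonal is the
   limit. *)
pose s := FPSeries (fun m => st (mdeg m).+1 m).
have near j : ord_ge j (s - st j).
  move=> m lt; have := far (mdeg m).+1 (j - (mdeg m).+1)%N.
  rewrite subnK // => /(_ m (ltnSn _)); rewrite !fpsD_coef !fpsN_coef /= => /eqP.
  by rewrite subr_eq0 => /eqP ->; rewrite subrr.
have prv d u : ord_ge d u -> ord_ge d (phi u).
  move=> ou; rewrite -[phi u](subrK u); apply: ord_geD (ou).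
  by apply: (@ord_geW d.+1) => //; apply: ro.
exists s; apply/eqP; rewrite -subr_eq0; apply/eqP/ord_ge_eq0 => d.
have -> : phi s - t = phi (s - st d) - (st d.+1 - st d).
  rewrite (raddfB phi).
  by rewrite E; set a := phi (st d); ring.
by apply: ord_geB; [apply: prv | apply: step].
Qed.

Lemma raises_order_bij (phi : {additive fpseries n k -> fpseries n k}) :
  raises_order phi -> bijective phi.
Proof.
move=> ro; have surj := raises_order_surj ro.
(* On the kernel [phi s - s] is [- s], so the order of [s] grows without bound. *)
have inj : injective phi.
  apply: raddf_inj => s s0; apply: ord_ge_eq0; elim=> // d IH.
  by have := ord_geN (ro _ _ IH); rewrite s0 sub0r opprK.
pose psi t := sval (cid (surj t)).
have psiK : cancel psi phi by move=> t; apply: (svalP (cid (surj t))).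
by exists psi => // s; apply: inj; rewrite psiK.
Qed.

(** Multiplication by [s], normalized to constant term 1, is the identity up to terms of higher
    order, hence reaches 1: the geometric series without writing it down. *)
Lemma fps_unit s : s 0%MM != 0 -> exists t, t * s = 1.
Proof.
move=> s0; pose c := (s 0%MM)^-1.
pose phi : {additive fpseries n k -> fpseries n k} := GRing.mull_fun (c *: s) idfun.
have ro : raises_order phi.
  rewrite /phi => d t ot; rewrite -{2}[t]mul1r -mulrBl -addn1 addnC.
  apply: ord_geM => //; apply/ord_ge1P.
  by rewrite fpsD_coef fpsN_coef fpsZ_coef fps1_coef eqxx mulVf ?subrr.
have [t /= et] := raises_order_surj ro 1.
by exists (c *: t); rewrite mulrC -scalerAr scalerAl.
Qed.

End OrderFiltration.

(** * Pairing, order and dual maps *)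

Section PairingOrder.
Variables (n : nat) (k : fieldType).
Implicit Types (s t u : fpseries n k) (f g : dpspace n k) (m h : 'X_{1..n}).

Lemma pairing_ord_ge d s f : (msize f <= d)%N -> ord_ge d s -> pairing s f = 0.
Proof.
move=> le os; rewrite (pairingwE _ le) big1 // => m _.
by rewrite os ?mul0r ?bmdeg.
Qed.

Lemma pairingZl (c : k) s f : pairing (c *: s) f = c * pairing s f.
Proof. by rewrite /pairing mulr_sumr; apply: eq_bigr => m _; rewrite /= mulrA. Qed.

Lemma pairingNl s f : pairing (- s) f = - pairing s f.
Proof. by rewrite -scaleN1r pairingZl mulN1r. Qed.

Lemma pairingBl s t f : pairing (s - t) f = pairing s f - pairing t f.
Proof. by rewrite pairingDl pairingNl. Qed.

Lemma pairing_suml (I : Type) (r : seq I) (P : pred I) (F : I -> fpseries n k) f :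
  pairing (\sum_(i <- r | P i) F i) f = \sum_(i <- r | P i) pairing (F i) f.
Proof.
by elim/big_rec2: _ => [|i x y _ <-]; rewrite ?pairing0l ?pairingDl.
Qed.

Lemma pairingDr s f g : pairing s (f + g) = pairing s f + pairing s g.
Proof. exact: linearD. Qed.

Lemma pairing_homog0 d s f : f \is d.-homog ->
  (forall m, mdeg m = d -> s m = 0) -> pairing s f = 0.
Proof.
move=> hf s0; rewrite /pairing big1_seq // => m /andP[_ sm].
by rewrite s0 ?mul0r //; apply: (dhomog_mf hf).
Qed.

Lemma pairing_homog_ord d s f :
  f \is d.-homog -> ord_ge d.+1 s -> pairing s f = 0.
Proof. by move=> hf os; apply: (pairing_homog0 hf) => m dm; rewrite os // dm. Qed.

Lemma ord_ge_tail d s :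
  ord_ge d (s - \sum_(h : 'X_{1..n < d}) s h *: fpsXm k h).
Proof.
move=> m lt; rewrite fpsD_coef fpsN_coef fps_sum_coef (bigD1 (BMultinom lt)) //.
rewrite big1 => [|h ne].
  by rewrite Monoid.mulm1 fpsZ_coef fpsXm_coef eqxx mulr1 subrr.
rewrite fpsZ_coef fpsXm_coef (_ : (m == h) = false) ?mulr0 //.
  by apply: contraNF ne => /eqP e; apply/eqP/val_inj.
Qed.

Definition preserves_order (phi : fpseries n k -> fpseries n k) :=
  forall d s, ord_ge d s -> ord_ge d (phi s).

(** Elements of P are the functionals vanishing on a power of the maximal ideal; preserving order
    keeps [pairing (phi s) f] of this kind, as a functional of [s]. *)
Lemma dual_image_exists (phi : {linear fpseries n k -> fpseries n k}) f :
  preserves_order phi -> exists g, is_dual_image phi f g.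
Proof.
move=> po; pose d := msize f.
exists (\sum_(h : 'X_{1..n < d}) pairing (phi (fpsXm k h)) f *: 'X_[h]) => s.
have le : (msize f <= d)%N by [].
rewrite -[in RHS](subrK (\sum_(h : 'X_{1..n < d}) s h *: fpsXm k h) s).
rewrite (linearD phi) pairingDl (pairing_ord_ge le) ?add0r; last first.
  exact/po/ord_ge_tail.
rewrite linear_sum (linear_sum phi) pairing_suml; apply: eq_bigr => h _.
by rewrite !linearZ /= pairingX pairingZl mulrC.
Qed.

Lemma G_orbit_trans f g r : G_orbit f g -> G_orbit g r -> G_orbit f r.
Proof.
move=> [phi Gphi dphi] [psi Gpsi dpsi]; exists (phi \o psi); first exact: in_G_comp.
by move=> s; rewrite dpsi dphi.
Qed.

(** [in_G_inv] presupposes a two-sided inverse; the claim [cc] supplies one by induction on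
    [in_G]. *)
Lemma G_orbit_sym f g : G_orbit f g -> G_orbit g f.
Proof.
have cc (phi : fpseries n k -> fpseries n k) : in_G phi -> exists2 psi, cancel phi psi & cancel psi phi.
  apply: (in_G_ind (P := fun phi => exists2 psi, cancel phi psi & cancel psi phi)).
  - by move=> {}phi [psi K K']; exists psi.
  - move=> u v vu; exists (fun s => v * s) => s; first by rewrite mulrA vu mul1r.
    by rewrite mulrA [u * v]mulrC vu mul1r.
  - move=> {}phi psi _ [f1 K1 K1'] _ [f2 K2 K2']; exists (f2 \o f1) => s /=.
      by rewrite K1 K2.
    by rewrite K2' K1'.
  - by move=> {}phi psi _ _ K K'; exists phi.
move=> [phi Gphi dphi]; have [psi K K'] := cc _ Gphi.
exists psi; first exact: in_G_inv Gphi K K'.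
by move=> s; rewrite dphi K'.
Qed.

End PairingOrder.

(** * Substitution endomorphisms of power series *)

Section Substitution.
Variables (n : nat) (k : fieldType) (g : 'I_n -> fpseries n k).
Local Notation S := (fpseries n k).
Hypothesis og : forall i, ord_ge 1 (g i).
Implicit Types (s t : S) (p q : {mpoly k[n]}) (m h : 'X_{1..n}) (c : k).

Local Notation ev := (mmap (GRing.in_alg S) g).

Lemma ord_ge_mmap1 m : ord_ge (mdeg m) (mmap1 g m).
Proof.
rewrite mdegE /mmap1; elim/big_rec2: _ => // i d s _ os.
by apply: ord_geM os; apply: ord_geX.
Qed.

Lemma ord_ge_mmap d p :
  (forall h, (mdeg h < d)%N -> p@_h = 0) -> ord_ge d (ev p).
Proof.
move=> p0; rewrite /mmap; apply: ord_ge_sum => m _.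
have [lt | le] := ltnP (mdeg m) d.
  by rewrite p0 // rmorph0 mul0r.
exact/ord_geMl/(ord_geW le)/ord_ge_mmap1.
Qed.

(** Every [g i] lies in the maximal ideal, so terms of degree above [mdeg m] do not contribute to
    the coefficient of [m], and a truncation suffices. *)
Definition fps_subst s : S :=
  FPSeries (fun m => ev (fps_trunc (mdeg m).+1 s) m).

Lemma fps_substE d s : ord_ge d (fps_subst s - ev (fps_trunc d s)).
Proof.
move=> m lt; rewrite fpsD_coef fpsN_coef /=.
rewrite -fpsN_coef -fpsD_coef -rmorphB.
apply: (@ord_ge_mmap (mdeg m).+1) => // h lth.
by rewrite mcoeffB !fps_truncE ?subrr // (leq_trans _ lt).
Qed.

Lemma fps_subst_low d s p :
  (forall h, (mdeg h < d)%N -> s h = p@_h) -> ord_ge d (fps_subst s - ev p).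
Proof.
move=> eqp; rewrite -(subrKA (ev (fps_trunc d s))); apply: ord_geD.
  exact: fps_substE.
rewrite -rmorphB; apply: ord_ge_mmap => h lt.
by rewrite mcoeffB fps_truncE // eqp // subrr.
Qed.

(** Transfers identities from polynomial evaluation: [s] and [t] are compared through polynomials
    agreeing with [s] to any given order. *)
Lemma fps_subst_eq s t :
  (forall d, exists2 p, forall h, (mdeg h < d)%N -> s h = p@_h & ord_ge d (t - ev p)) ->
  fps_subst s = t.
Proof.
move=> H; apply/eqP; rewrite -subr_eq0; apply/eqP/ord_ge_eq0 => d.
have [p /fps_subst_low o1 o2] := H d.
by rewrite -(subrKA (ev p)); apply: ord_geD => //; rewrite -opprB; apply: ord_geN.
Qed.

Fact fps_subst_linear : linear fps_subst.
Proof.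
move=> c s t; apply: fps_subst_eq => d.
exists (c *: fps_trunc d s + fps_trunc d t).
  by move=> h lt; rewrite mcoeffD mcoeffZ !fps_truncE.
rewrite mmapD mmapZ [X in X * _]/= -scalerAl mul1r opprD addrACA -scalerBr.
by apply: ord_geD; [apply: ord_geZ|]; apply: fps_substE.
Qed.

Fact fps_subst_monoid : monoid_morphism fps_subst.
Proof.
split.
  apply: fps_subst_eq => d; exists 1; last by rewrite rmorph1 subrr.
  by move=> h _; rewrite mcoeff1.
move=> s t; apply: fps_subst_eq => d.
exists (fps_trunc d s * fps_trunc d t).
  by move=> h lt; rewrite -(fps_mul_trunc _ _ lt).
have -> : ev (fps_trunc d s * fps_trunc d t) = ev (fps_trunc d s) * ev (fps_trunc d t).
  exact: rmorphM.
set a' := ev (fps_trunc d s); set b' := ev (fps_trunc d t).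
set a := fps_subst s; set b := fps_subst t.
have -> : a * b - a' * b' = a * (b - b') + b' * (a - a') by ring.
by apply: ord_geD; apply: ord_geMl; apply: fps_substE.
Qed.

Lemma fps_substX i : fps_subst (fpsXm k U_(i)) = g i.
Proof.
apply: fps_subst_eq => d; exists 'X_i.
  by move=> h _; rewrite mcoeffX eq_sym.
by rewrite mmapX mmap1U subrr.
Qed.

Lemma fps_substitution :
  exists phi : {lrmorphism S -> S}, forall i, phi (fpsXm k U_(i)) = g i.
Proof.
pose phi : {lrmorphism S -> S} := HB.pack fps_subst
  (GRing.isLinear.Build k S S *:%R fps_subst fps_subst_linear)
  (GRing.isMonoidMorphism.Build S S fps_subst fps_subst_monoid).
by exists phi; apply: fps_substX.
Qed.

End Substitution.

(** * Endomorphisms close to the identity *)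

Section NearIdentity.
Variables (n : nat) (k : fieldType) (phi : {lrmorphism fpseries n k -> fpseries n k}).

Let phiM x y : phi (x * y) = phi x * phi y.
Proof. exact: rmorphM. Qed.
Let phi_sum (t : 'I_n -> fpseries n k) : phi (\sum_i t i) = \sum_i phi (t i).
Proof. exact: linear_sum. Qed.

Lemma lrmorphism_preserves_order :
  (forall i, ord_ge 1 (phi (fpsXm k U_(i)%MM))) -> preserves_order phi.
Proof.
move=> oX; elim=> // d IH s /ord_geS_split[r os ->].
rewrite phi_sum; apply: ord_ge_sum => i _; rewrite phiM.
by apply: (@ord_geM _ _ 1); last exact: IH.
Qed.

Variable e : nat.
Hypothesis phiX : forall i, ord_ge e.+1 (phi (fpsXm k U_(i)) - fpsXm k U_(i)%MM).

Lemma near_identity_preserves : preserves_order phi.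
Proof.
apply: lrmorphism_preserves_order => i.
rewrite -[phi _](subrK (fpsXm k U_(i)%MM)); apply: ord_geD.
  by apply: ord_geW (phiX i).
by rewrite -(mdeg1 i); apply: ord_ge_Xm.
Qed.

(** Induction on [d] along a Leibniz-type splitting of [phi (X_i t_i) - X_i t_i]. At [d = 0] the
    cofactors [t_i] again have order 0 only, and the factor [X_i] gains one order; hence the outer
    induction on the bound [e']. *)
Lemma near_identity d s : ord_ge d s -> ord_ge (d + e) (phi s - s).
Proof.
suff: forall e', (e' <= e)%N ->
    forall d s, ord_ge d s -> ord_ge (d + e') (phi s - s) by exact.
elim=> {d s} [|e' IHe] le.
  by move=> d s os; rewrite addn0; apply: ord_geB => //; apply: near_identity_preserves.
have split d t : (forall i, ord_ge d (phi (fpsXm k U_(i)%MM) * phi (t i) -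
      fpsXm k U_(i)%MM * t i)) ->
    ord_ge d (phi (\sum_i fpsXm k U_(i)%MM * t i) - \sum_i fpsXm k U_(i)%MM * t i).
  move=> ot; rewrite phi_sum -sumrB; apply: ord_ge_sum => i _.
  by rewrite phiM; apply: ot.
have termE (x y r r' : fpseries n k) : x * r' - y * r = (x - y) * r' + y * (r' - r).
  by ring.
elim=> [|d IHd] s os.
  rewrite -[s](subrK (s 0%MM)%:A); have := ord_ge_const s.
  set t := s - _; rewrite linearD linearZ_LR rmorph1 opprD addrACA subrr addr0. 
  case/ord_geS_split => r _ ->; apply: split => i; rewrite termE; apply: ord_geD.
    by apply: ord_geMr; apply: ord_geW (phiX i); rewrite add0n ltnW.
  apply: (@ord_geM _ _ 1); last by apply: (IHe _ 0%N) => //; apply: ltnW.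
  by rewrite -(mdeg1 i); apply: ord_ge_Xm.
case/ord_geS_split: os => r os ->; apply: split => i; rewrite termE; apply: ord_geD.
  apply: (@ord_geW _ _ (e.+1 + d)); first by lia.
  by apply: ord_geM (near_identity_preserves _); [apply: phiX | apply: os].
rewrite [(d.+1 + _)%N]addSn; apply: (@ord_geM _ _ 1); last exact: IHd.
by rewrite -(mdeg1 i); apply: ord_ge_Xm.
Qed.

End NearIdentity.


(** * Finite-dimensional linear algebra *)

Section LinearAlgebra.
Variable k : fieldType.

(** A matrix of maximal rank among those with row space inside [V] works: a vector of [V] outside
    its row space would raise the rank. *)
Lemma subspace_row_span (D : nat) (V : 'rV[k]_D -> Prop) :
    V 0 -> (forall c u v, V u -> V v -> V (c *: u + v)) ->
  exists M : 'M[k]_D, forall v, V v <-> (v <= M)%MS.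
Proof.
move=> V0 Vlin.
pose P r := `[< exists2 M : 'M[k]_D, \rank M = r & forall v, (v <= M)%MS -> V v >].
have P0 : exists r, P r.
  exists 0%N; apply/asboolP; exists 0; first exact: mxrank0.
  by move=> v; rewrite submx0 => /eqP ->.
have Pmax r : P r -> (r <= D)%N by move=> /asboolP[M <- _]; apply: rank_leq_row.
case: (ex_maxnP P0 Pmax) => r /asboolP[M rM MV] maxr; exists M => v.
split; last exact: MV; move=> Vv; apply/negPn/negP => nle.
have /maxr : P (\rank (M + v)%MS).
  apply/asboolP; exists (M + v)%MS => // w /sub_addsmxP[[a b] /= ->].
  rewrite (_ : b = b 0 0 *: 1%:M); last by rewrite scalemx1 -mx11_scalar.
  by rewrite -scalemxAl mul1mx addrC; apply: Vlin => //; apply/MV/submxMl.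
rewrite -rM leqNgt => /negP; apply.
rewrite ltn_neqAle mxrankS ?addsmxSl // andbT.
apply: contra nle => /eqP eqr; apply: submx_trans (addsmxSr M v) _.
by rewrite -(geq_leqif (mxrank_leqif_sup (addsmxSl M v))) eqr.
Qed.

(** Ideals pull back to subspaces of row vectors along the spanning family; a chain is stationary
    once its rank is minimal. *)
Lemma spanned_artinian (A : comAlgType k) (I : finType) (b : I -> A) :
  (forall x : A, exists c : I -> k, x = \sum_i c i *: b i) -> artinian A.
Proof.
move=> span J Jid Jdec; set D := #|I|.
pose L (v : 'rV[k]_D) : A := \sum_i v 0 (enum_rank i) *: b i.
have Llin c u v : L (c *: u + v) = c *: L u + L v.
  rewrite /L scaler_sumr -big_split; apply: eq_bigr => i _.
  by rewrite !mxE scalerDl scalerA.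
have Lsurj x : exists v, x = L v.
  have [c ->] := span x; exists (\row_j c (enum_val j)).
  by apply: eq_bigr => i _; rewrite mxE enum_rankK.
have L0 : L 0 = 0 by rewrite /L big1 // => i _; rewrite mxE scale0r.
have /choice[M MP] i : exists M : 'M[k]_D, forall v, L v \in J i <-> (v <= M)%MS.
  have [J0 _ Jcl] := Jid i; apply: subspace_row_span => [|c u v Ju Jv].
    by rewrite L0.
  by rewrite Llin -[L u]mul1r scalerAl; apply: Jcl.
have Mdec i j : (i <= j)%N -> (M j <= M i)%MS.
  move=> le; apply/row_subP => r; apply/MP.
  have : L (row r (M j)) \in J j by apply/MP/row_sub.
  elim: j le {r} (row _ _) => [|j IH]; first by rewrite leqn0 => /eqP ->.
  rewrite leq_eqVlt => /orP[/eqP -> //| lt] v /Jdec; exact: IH.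
pose P r := `[< exists i, \rank (M i) = r >].
have P0 : exists r, P r by exists (\rank (M 0)); apply/asboolP; exists 0%N.
case: (ex_minnP P0) => r /asboolP[N rN] minr; exists N => i le x.
have [v ->] := Lsurj x; have eqM : (M N <= M i)%MS.
  rewrite -(geq_leqif (mxrank_leqif_sup (Mdec _ _ le))) rN.
  by apply: minr; apply/asboolP; exists i.
by apply/idP/idP => /MP vM; apply/MP/(submx_trans vM) => //; apply: Mdec.
Qed.

Lemma linear_relation (N D : nat) (a : 'I_N -> 'I_D -> k) : (D < N)%N ->
  exists2 u : 'I_N -> k, exists i, u i != 0 & forall j, \sum_i u i * a i j = 0.
Proof.
move=> lt; pose M : 'M[k]_(N, D) := \matrix_(i, j) a i j.
have : kermx M != 0.
  rewrite -mxrank_eq0 mxrank_ker subn_eq0 -ltnNge.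
  exact: leq_ltn_trans (rank_leq_col _) lt.
case/rowV0Pn => u /sub_kermxP uM nz; exists (u 0).
  apply/existsP; apply: contraNT nz; rewrite negb_exists => /forallP u0.
  by apply/eqP/rowP => i; rewrite mxE; move/negPn/eqP: (u0 i).
move=> j; have := congr1 (fun B : 'rV_D => B 0 j) uM; rewrite !mxE => uM0.
by rewrite -[RHS]uM0; apply: eq_bigr => i _; rewrite mxE.
Qed.

(** The columns of [cokermx M] solve the homogeneous system, so by hypothesis they kill [vr], which
    therefore lies in the row space of [M]. *)
Lemma fredholm (I J : finType) (a : I -> J -> k) (v : J -> k) :
    (forall w : J -> k, (forall i, \sum_j a i j * w j = 0) -> \sum_j v j * w j = 0) ->
  exists u : I -> k, forall j, \sum_i u i * a i j = v j.
Proof.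
move=> H; pose M := \matrix_(i < #|I|, j < #|J|) a (enum_val i) (enum_val j).
pose vr := \row_(j < #|J|) v (enum_val j).
have reidx (T : finType) (g : T -> k) : \sum_(i < #|T|) g (enum_val i) = \sum_i g i.
  by rewrite [RHS](reindex _ (onW_bij _ (enum_val_bij T))).
have : (vr <= M)%MS.
  rewrite submxE; apply/eqP/rowP => c; rewrite !mxE.
  pose w j := cokermx M (enum_rank j) c.
  rewrite -[RHS](H w) => [|i].
    rewrite -[RHS]reidx; apply: eq_bigr => j _; by rewrite mxE /w enum_valK.
  have := congr1 (fun B : 'M_(_, _) => B (enum_rank i) c) (mulmx_coker M).
  rewrite !mxE => M0; rewrite -[RHS]M0 -reidx; apply: eq_bigr => j _.
  by rewrite mxE /w enum_rankK enum_valK.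
case/submxP => u uM; exists (fun i => u 0 (enum_rank i)) => j.
have := congr1 (fun B : 'rV_(_) => B 0 (enum_rank j)) uM.
rewrite !mxE enum_rankK => ->; rewrite -reidx; apply: eq_bigr => i _.
by rewrite mxE enum_rankK enum_valK.
Qed.

End LinearAlgebra.

(** * Apolar algebras *)

Section ApolarAlgebra.
Variables (n : nat) (k : fieldType) (f : dpspace n k) (f0 : f != 0).
Local Notation S := (fpseries n k).
Local Notation A := (Apolar f0).
Implicit Types (s t u : S) (x y : A).

Definition apolar_pi s : A := \pi_{ideal_quot (annihilator_ideal f0)} s.
Local Notation pi := apolar_pi.

Lemma apolar_pi_eq s t : pi s = pi t <-> s - t \in annihilator f.
Proof.
by rewrite /pi -[X in _ <-> X]/(is_true (s - t \in annihilator_ideal f0)) Quotient.idealrBE;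
  split=> [->|/eqP].
Qed.

Lemma apolar_pi_eq0 s : pi s = 0 <-> forall t, pairing (t * s) f = 0.
Proof.
have -> : 0 = pi 0 by rewrite /pi rmorph0.
by rewrite apolar_pi_eq subr0; split=> /annihilatorP.
Qed.

Lemma apolar_piD s t : pi (s + t) = pi s + pi t. Proof. exact: rmorphD. Qed.
Lemma apolar_piB s t : pi (s - t) = pi s - pi t. Proof. exact: rmorphB. Qed.
Lemma apolar_piM s t : pi (s * t) = pi s * pi t. Proof. exact: rmorphM. Qed.
Lemma apolar_pi0 : pi 0 = 0. Proof. exact: rmorph0. Qed.
Lemma apolar_pi1 : pi 1 = 1. Proof. exact: rmorph1. Qed.
Lemma apolar_piX s d : pi (s ^+ d) = pi s ^+ d. Proof. exact: rmorphXn. Qed.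
Lemma apolar_pi_sum (I : Type) (r : seq I) (P : pred I) (F : I -> S) :
  pi (\sum_(i <- r | P i) F i) = \sum_(i <- r | P i) pi (F i).
Proof. exact: rmorph_sum. Qed.

Lemma apolar_piZ (c : k) s : pi (c *: s) = c *: pi s.
Proof. by rewrite -[in LHS](mul1r s) scalerAl apolar_piM. Qed.

Lemma apolar_pi_surj x : exists s, x = pi s.
Proof. by exists (repr x); rewrite /pi reprK. Qed.


Definition apolar_filt (i : nat) : {pred A} :=
  [pred x | `[< exists2 s, ord_ge i s & x = pi s >]].

Lemma apolar_filtP i x :
  reflect (exists2 s, ord_ge i s & x = pi s) (x \in apolar_filt i).
Proof. exact: asboolP. Qed.

(** [mlead f] has maximal degree in [f], so any non-constant factor leads beyond [f]. The class of
    this monomial will generate the socle. *)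
Lemma pairing_top s :
  pairing (fpsXm k (mlead f) * s) f = s 0%MM * f@_(mlead f).
Proof.
rewrite -[s in LHS](subrK (s 0%MM)%:A) mulrDr pairingDl.
rewrite (@pairing_ord_ge _ _ (msize f)) ?add0r //; last first.
  rewrite -(mlead_deg f0) -addn1; apply: ord_geM; first exact: ord_ge_Xm.
  exact: ord_ge_const.
by rewrite -scalerAr mulr1 pairingZl pairing_Xm.
Qed.

Lemma mlead_coef_neq0 : f@_(mlead f) != 0.
Proof. by rewrite -/(mleadc f) mleadc_eq0. Qed.

Lemma annihilator_const s : s \in annihilator f -> s 0%MM = 0.
Proof.
move/annihilatorP/(_ (fpsXm k (mlead f))); rewrite pairing_top => /eqP.
by rewrite mulf_eq0 (negPf mlead_coef_neq0) orbF => /eqP.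
Qed.

Lemma apolar_filt1_pi s : (pi s \in apolar_filt 1) = (s 0%MM == 0).
Proof.
apply/apolar_filtP/eqP => [[t /ord_ge1P ot /apolar_pi_eq/annihilator_const] | s0].
  by rewrite fpsD_coef fpsN_coef ot subr0.
by exists s => //; apply/ord_ge1P.
Qed.

Lemma apolar_filt1_ideal : idealr_closed (apolar_filt 1).
Proof.
split; first by rewrite -apolar_pi0 apolar_filt1_pi.
  by rewrite -apolar_pi1 apolar_filt1_pi fps1_coef eqxx oner_eq0.
move=> a x y /apolar_filtP[s os ->] /apolar_filtP[t ot ->].
have [r ->] := apolar_pi_surj a; rewrite -apolar_piM -apolar_piD.
by apply/apolar_filtP; eexists; last reflexivity; apply: ord_geD => //; apply: ord_geMl.
Qed.

Lemma proper_ideal_sub_filt1 (I : {pred A}) :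
  idealr_closed I -> {subset I <= apolar_filt 1}.
Proof.
move=> [I0 I1 Icl] x; have [s ->] := apolar_pi_surj x.
rewrite apolar_filt1_pi => Is; apply: contraNT I1 => /fps_unit[t ts].
by rewrite -apolar_pi1 -ts apolar_piM -[_ * _]addr0; apply: Icl.
Qed.

Lemma apolar_local : local_with (apolar_filt 1).
Proof.
split; first split; first exact: apolar_filt1_ideal.
  move=> I Iid sI x; apply/idP/idP; last exact: sI.
  exact: proper_ideal_sub_filt1.
move=> m [mid mmax] x; rewrite (mmax (apolar_filt 1)) //.
  exact: apolar_filt1_ideal.
exact: proper_ideal_sub_filt1.
Qed.

Lemma apolar_residue_field : residue_field_is_base (apolar_filt 1).
Proof.
move=> x; have [s ->] := apolar_pi_surj x; exists (s 0%MM).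
rewrite -apolar_pi1 -apolar_piZ -apolar_piB apolar_filt1_pi.
exact/eqP/ord_ge1P/ord_ge_const.
Qed.

Lemma apolar_ideal_exp i : ideal_exp (apolar_filt 1) i = apolar_filt i.
Proof.
elim: i => [|i IH].
  apply/funext => x; apply/esym/apolar_filtP.
  by have [s ->] := apolar_pi_surj x; exists s.
rewrite /ideal_exp iterS -/(ideal_exp _ _) IH; apply/funext => x.
apply/asboolP/apolar_filtP => [[r [a [b [ab ->]]]] | [s /ord_geS_split[t ot ->] ->]].
  elim/big_ind: _ => [|y z [s os ->] [t ot ->] | j _].
  - by exists 0 => //; rewrite apolar_pi0.
  - by exists (s + t); [apply: ord_geD | rewrite apolar_piD].
  have [/apolar_filtP[s os ->] /apolar_filtP[t ot ->]] := ab j.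
  by exists (s * t); [rewrite -add1n; apply: ord_geM | rewrite apolar_piM].
exists n, (fun j => pi (fpsXm k U_(j)%MM)), (fun j => pi (t j)); split.
  move=> j; split; apply/apolar_filtP; last by exists (t j).
  by eexists; last reflexivity; rewrite -(mdeg1 j); apply: ord_ge_Xm.
by rewrite apolar_pi_sum; apply: eq_bigr => j _; rewrite apolar_piM.
Qed.

Lemma apolar_pi_ord s : ord_ge (msize f) s -> pi s = 0.
Proof.
by move=> os; apply/apolar_pi_eq0 => t; apply: (pairing_ord_ge (leqnn _)); apply: ord_geMl.
Qed.

Lemma apolar_artinian : artinian A.
Proof.
apply: (@spanned_artinian _ _ 'X_{1..n < msize f} (fun h => pi (fpsXm k (val h)))) => x.
have [s ->] := apolar_pi_surj x; exists (fun h => s (val h)); apply/eqP.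
rewrite -(eq_bigr _ (fun h _ => apolar_piZ (s (val h)) (fpsXm k (val h)))) -apolar_pi_sum.
by rewrite -subr_eq0 -apolar_piB apolar_pi_ord //; apply: ord_ge_tail.
Qed.

(** For [s] in the socle, [pairing (t * s) f] depends on the constant term of [t] only; the same
    holds for the leading monomial, so the two classes are proportional. *)
Lemma apolar_gorenstein : gorenstein_with (apolar_filt 1).
Proof.
pose c := f@_(mlead f); have c0 : c != 0 := mlead_coef_neq0.
pose s0 := fpsXm k (mlead f); pose e (j : 'I_1) : A := pi s0.
have lift_const t : t = (t - (t 0%MM)%:A) + (t 0%MM)%:A by rewrite subrK.
have topE t : pairing (t * s0) f = t 0%MM * c by rewrite mulrC pairing_top.
exists e; split.
  move=> j; apply/asboolP => b /apolar_filtP[s /ord_ge1P os ->].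
  rewrite -apolar_piM; apply/apolar_pi_eq0 => t; rewrite mulrA topE.
  suff -> : (t * s) 0%MM = 0 by rewrite mul0r.
  by apply/ord_ge1P/ord_geMl/ord_ge1P.
move=> v /asboolP; have [s ->] := apolar_pi_surj v => soc.
have socE t : pairing (t * s) f = t 0%MM * pairing s f.
  rewrite {1}(lift_const t) mulrDl pairingDl -scalerAl mul1r pairingZl.
  have : pi (t - (t 0%MM)%:A) * pi s = 0.
    by apply: soc; rewrite apolar_filt1_pi; apply/eqP/ord_ge1P/ord_ge_const.
  rewrite -apolar_piM => /apolar_pi_eq0/(_ 1).
  by rewrite mul1r => ->; rewrite add0r.
exists (\row_j (pairing s f / c)); split.
  rewrite big_ord1 mxE inE -apolar_piZ -apolar_piB; apply/eqP/apolar_pi_eq0 => t.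
  by rewrite mulrBr pairingBl -scalerAr pairingZl topE socE mulrCA divfK ?subrr.
move=> d; rewrite big_ord1 inE -apolar_piZ -apolar_piB => /eqP/apolar_pi_eq0/(_ 1).
rewrite mul1r pairingBl pairingZl -[s0]mul1r topE fps1_coef eqxx mul1r => /eqP.
rewrite subr_eq0 => /eqP ->; apply/rowP => j.
by rewrite mxE (ord1 j) mulfK.
Qed.

Lemma apolar_local_artinian_gorenstein : local_artinian_gorenstein A.
Proof.
exists (apolar_filt 1); split.
- exact: apolar_local.
- exact: apolar_residue_field.
- exact: apolar_artinian.
- exact: apolar_gorenstein.
Qed.

End ApolarAlgebra.

Arguments apolar_pi {n k f} f0 s.
Arguments apolar_filt {n k f} f0 i.
Arguments apolar_local {n k f} f0.

(** * Degenerate ternary cubics *)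

Notation o0 := (@Ordinal 3 0 isT).
Notation o1 := (@Ordinal 3 1 isT).
Notation o2 := (@Ordinal 3 2 isT).

Lemma ord3P (P : 'I_3 -> Prop) : P o0 -> P o1 -> P o2 -> forall i, P i.
Proof.
move=> P0 P1 P2 [[|[|[|i]]] lt] //.
- by rewrite (_ : Ordinal lt = o0) //; apply: val_inj.
- by rewrite (_ : Ordinal lt = o1) //; apply: val_inj.
- by rewrite (_ : Ordinal lt = o2) //; apply: val_inj.
Qed.

Lemma sum_ord3 (V : zmodType) (F : 'I_3 -> V) : \sum_i F i = F o0 + F o1 + F o2.
Proof.
rewrite !big_ord_recl big_ord0 addr0 addrA.
by congr (F _ + F _ + F _); apply: val_inj.
Qed.

Section ClosedField.
Variable k : closedFieldType.

Lemma closed_root_exists (d : nat) (x : k) : (0 < d)%N -> exists r, r ^+ d = x.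
Proof.
move=> d0; have /closed_rootP[r] : size ('X^d - x%:P) != 1%N.
  by rewrite size_XnsubC // eqSS -lt0n.
by rewrite rootE !hornerE subr_eq0 => /eqP; exists r.
Qed.

Lemma binary_quadric_root (a b c : k) :
  exists s t : k, (s != 0) || (t != 0) /\ a * s ^+ 2 + b * (s * t) + c * t ^+ 2 = 0.
Proof.
have [-> | a0] := eqVneq a 0.
  exists 1, 0; split; first by rewrite oner_eq0.
  by rewrite mul0r mulr0 mulr0 expr0n mulr0 !addr0.
have sz : size (a *: 'X^2 + (b *: 'X + c%:P)) = 3%N.
  rewrite size_polyDl size_scale ?size_polyXn //.
  rewrite (leq_ltn_trans (size_polyD _ _)) // gtn_max.
  rewrite (leq_ltn_trans (size_scale_leq _ _)) ?size_polyX //=.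
  by rewrite (leq_ltn_trans (size_polyC_leq1 _)).
have /closed_rootP[s] : size (a *: 'X^2 + (b *: 'X + c%:P)) != 1%N by rewrite sz.
rewrite rootE !hornerE => /eqP rs; exists s, 1; split; first by rewrite oner_eq0 orbT.
by rewrite -[RHS]rs /=; ring.
Qed.

(* [T] is a binary cubic in disguise; the zeros of its Hessian are the
   directions in which its polar quadric is a square. *)
Lemma degenerate_cubic_polar_square (T : 'I_3 -> 'I_3 -> 'I_3 -> k) (a : 'I_3 -> k) :
    (forall x y z, T x y z = T y x z) -> (forall x y z, T x y z = T x z y) ->
    (exists x, a x != 0) -> (forall y z, \sum_x a x * T x y z = 0) ->
    (exists x y z, T x y z != 0) ->
  exists v c : 'I_3 -> k,
    (exists x, c x != 0) /\ forall y z, \sum_x v x * T x y z = c y * c z.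
Proof.
move=> T12 T23 [i0 ai0] Ta [x1 [y1 [z1 T1]]].
(* The relation [a] expresses one slice of [T] through the slices [j0] and [l0], so that [T] becomes
   a binary cubic in the linear forms [e1] and [e2]. *)
have [j0 [l0 [e1 [e2 [Te [[ej1 ej2] [el1 el2]]]]]]] : exists j0 l0 e1 e2,
    (forall x y z, T x y z = e1 x * T j0 y z + e2 x * T l0 y z) /\
    ((e1 j0 = 1 /\ e2 j0 = 0) /\ (e1 l0 = 0 /\ e2 l0 = 1)).
  have solve b c d (B C D : k) : b != 0 -> b * B + c * C + d * D = 0 ->
      B = - c / b * C + - d / b * D.
    move=> b0 E; apply: (mulfI b0); rewrite -[LHS](addrK (c * C + d * D)) addrA E.
    by field.
  move: i0 ai0; apply: ord3P => ai.
  - exists o1, o2, (fun x => if x == o0 then - a o1 / a o0 else (x == o1)%:R),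
      (fun x => if x == o0 then - a o2 / a o0 else (x == o2)%:R); split=> //.
    apply: ord3P => y z /=; rewrite ?(mul0r, mul1r, add0r, addr0) //.
    by apply: solve => //; rewrite -(Ta y z) sum_ord3.
  - exists o0, o2, (fun x => if x == o1 then - a o0 / a o1 else (x == o0)%:R),
      (fun x => if x == o1 then - a o2 / a o1 else (x == o2)%:R); split=> //.
    apply: ord3P => y z /=; rewrite ?(mul0r, mul1r, add0r, addr0) //.
    by apply: solve => //; rewrite -[RHS](Ta y z) sum_ord3; ring.
  - exists o0, o1, (fun x => if x == o2 then - a o0 / a o2 else (x == o0)%:R),
      (fun x => if x == o2 then - a o1 / a o2 else (x == o1)%:R); split=> //.
    apply: ord3P => y z /=; rewrite ?(mul0r, mul1r, add0r, addr0) //.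
    by apply: solve => //; rewrite -[RHS](Ta y z) sum_ord3; ring.
pose A := T j0 j0 j0; pose B := T j0 j0 l0; pose C := T j0 l0 l0; pose D := T l0 l0 l0.
have TR x y z : T x y z = T z x y by rewrite T23 T12.
have Tj y z : T j0 y z = e1 y * e1 z * A + (e1 y * e2 z + e2 y * e1 z) * B
    + e2 y * e2 z * C.
  rewrite (T12 j0 y z) (Te y j0 z) (TR j0 j0 z) (Te z j0 j0) (T12 l0 j0 z).
  rewrite (TR j0 l0 z) (Te z j0 l0) (T12 l0 j0 j0) (T23 j0 l0 j0) (T12 l0 j0 l0).
  by rewrite -/A -/B -/C; ring.
have Tl y z : T l0 y z = e1 y * e1 z * B + (e1 y * e2 z + e2 y * e1 z) * C
    + e2 y * e2 z * D.
  rewrite (T12 l0 y z) (Te y l0 z) (TR j0 l0 z) (Te z j0 l0) (TR l0 l0 z).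
  by rewrite (Te z l0 l0) (T12 l0 j0 l0) -/B -/C -/D; ring.
(* The polar quadric in direction [(s, t)] has matrix entries [s * A + t * B], [s * B + t * C],
   [s * C + t * D]; it is a square once they are [g ^+ 2], [g * h], [h ^+ 2]. *)
have sq s t g h : s * A + t * B = g ^+ 2 -> s * B + t * C = g * h ->
    s * C + t * D = h ^+ 2 -> (g != 0) || (h != 0) ->
  exists v c : 'I_3 -> k,
    (exists x, c x != 0) /\ forall y z, \sum_x v x * T x y z = c y * c z.
  move=> E1 E2 E3 gh; exists (fun x => s * (x == j0)%:R + t * (x == l0)%:R).
  exists (fun x => g * e1 x + h * e2 x); split.
    case/orP: gh => nz; [exists j0 | exists l0].
      by rewrite ej1 ej2 mulr1 mulr0 addr0.
    by rewrite el1 el2 mulr1 mulr0 add0r.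
  move=> y z; transitivity (s * T j0 y z + t * T l0 y z).
    rewrite (eq_bigr (fun x => s * ((x == j0)%:R * T x y z)
        + t * ((x == l0)%:R * T x y z))); last by move=> x _; ring.
    rewrite big_split /= -!mulr_sumr; congr (_ * _ + _ * _).
      rewrite (bigD1 j0) //= eqxx mul1r big1 ?addr0 // => x /negPf ->.
      by rewrite mul0r.
    rewrite (bigD1 l0) //= eqxx mul1r big1 ?addr0 // => x /negPf ->.
    by rewrite mul0r.
  transitivity (e1 y * e1 z * (s * A + t * B)
      + (e1 y * e2 z + e2 y * e1 z) * (s * B + t * C)
      + e2 y * e2 z * (s * C + t * D)); first by rewrite Tj Tl; ring.
  by rewrite E1 E2 E3; ring.
(* These are the coefficients of the determinant of the polar matrix as a form in [s] and [t], that
   is, of the Hessian. *)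
have [s [t [st det0]]] :=
  binary_quadric_root (A * C - B ^+ 2) (A * D - B * C) (B * D - C ^+ 2).
have [g g2] := closed_root_exists (s * A + t * B) (isT : 0 < 2)%N.
have [h h2] := closed_root_exists (s * C + t * D) (isT : 0 < 2)%N.
(* Since the determinant vanishes, the off-diagonal entry is [g * h] up to sign; the sign is
   absorbed into [h]. *)
have /eqP : (s * B + t * C - g * h) * (s * B + t * C + g * h) = 0.
  by rewrite -subr_sqr exprMn g2 h2 -[RHS]oppr0 -det0; ring.
have [gh | /norP[/negPn/eqP g0 /negPn/eqP h0]] := boolP ((g != 0) || (h != 0)).
  rewrite mulf_eq0 subr_eq0 addr_eq0 => /orP[]/eqP E.
    exact: (sq s t g h).
  by apply: (sq s t g (- h)); rewrite ?sqrrN ?mulrN ?oppr_eq0.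
(* The polar quadric is zero in this direction, so the cubic is a multiple of the cube of one linear
   form; a coordinate direction, scaled by [A^-1] or [D^-1], gives the square of that form. *)
rewrite g0 h0 in g2 h2; rewrite g0 mul0r subr0 addr0 mulf_eq0 orbb => /eqP BC.
rewrite expr0n /= in g2 h2.
have [s0 | s0] := eqVneq s 0.
  have t0 : t != 0 by move: st; rewrite s0 eqxx.
  move: g2 BC h2; rewrite s0 !mul0r !add0r.
  move=> /esym/eqP; rewrite mulf_eq0 (negPf t0) /= => /eqP B0.
  move=> /eqP; rewrite mulf_eq0 (negPf t0) /= => /eqP C0.
  move=> /esym/eqP; rewrite mulf_eq0 (negPf t0) /= => /eqP D0.
  have A0 : A != 0.
    apply: contraNneq T1 => A0.
    by rewrite Te Tj Tl A0 B0 C0 D0 !mulr0 !addr0 !mulr0 addr0.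
  apply: (sq A^-1 0 1 0); rewrite ?oner_eq0 // ?B0 ?C0 ?D0; by field.
pose r := - t / s.
have EC : C = r * D by apply: (mulfI s0); rewrite -[LHS](addrK (t * D)) -h2 /r; field.
have EB : B = r * C by apply: (mulfI s0); rewrite -[LHS](addrK (t * C)) BC /r; field.
have EA : A = r * B by apply: (mulfI s0); rewrite -[LHS](addrK (t * B)) -g2 /r; field.
have D0 : D != 0.
  apply: contraNneq T1 => D0.
  by rewrite Te Tj Tl EA EB EC D0 !mulr0 !addr0 !mulr0 addr0.
by apply: (sq 0 D^-1 r 1); rewrite ?oner_eq0 ?orbT // ?EB ?EC; field.
Qed.

End ClosedField.

(** * Hilbert functions of apolar algebras *)

Section HilbertFunction.
Variables (n : nat) (k : fieldType).
Implicit Types (s t u : fpseries n k) (m h : 'X_{1..n}).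

Definition fps_homog d s := forall m, mdeg m != d -> s m = 0.

Lemma fps_homog_Xm h : fps_homog (mdeg h) (fpsXm k h).
Proof. by move=> m ne; rewrite fpsXm_coef (_ : (m == h) = false) //; apply: contraNF ne => /eqP ->. Qed.

Lemma fps_homogZ d c s : fps_homog d s -> fps_homog d (c *: s).
Proof. by move=> hs m md; rewrite fpsZ_coef hs ?mulr0. Qed.

Lemma fps_homog_sum d (I : Type) (r : seq I) (P : pred I) (F : I -> fpseries n k) :
  (forall i, P i -> fps_homog d (F i)) -> fps_homog d (\sum_(i <- r | P i) F i).
Proof. by move=> hF m md; rewrite fps_sum_coef big1 // => i Pi; apply: hF. Qed.

Lemma fps_homogM d e s t : fps_homog d s -> fps_homog e t -> fps_homog (d + e) (s * t).
Proof.
move=> hs ht m ne; apply: big1 => h /eqP em; have := congr1 mdeg em.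
rewrite mdegD => edeg; have [ed | /hs ->] := eqVneq (mdeg h.1) d; last by rewrite mul0r.
by rewrite ht ?mulr0 //; apply: contraNneq ne => ee; rewrite edeg ed ee.
Qed.

Lemma fps_homog_linear_form (c : 'rV[k]_n) : fps_homog 1 (linear_form c).
Proof.
apply: fps_homog_sum => i _; apply: fps_homogZ.
by have := @fps_homog_Xm U_(i)%MM; rewrite mdeg1.
Qed.

(** By homogeneity only monomials of complementary degree can pair nontrivially with [s], so testing
    on these is enough. *)
Lemma homog_annihilator d i s (F : dpspace n k) : F \is d.-homog -> (i <= d)%N ->
    fps_homog i s ->
    (forall m, mdeg m = (d - i)%N -> pairing (fpsXm k m * s) F = 0) ->
  s \in annihilator F.
Proof.
move=> hF le hs s0; apply/annihilatorP => t.
rewrite -[t](subrK (\sum_(h : 'X_{1..n < d.+1}) t h *: fpsXm k h)) mulrDl pairingDl.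
rewrite (pairing_homog_ord hF) ?add0r; last exact/ord_geMr/ord_ge_tail.
rewrite mulr_suml pairing_suml big1 // => h _; rewrite -scalerAl pairingZl.
have [/s0 -> | ne] := eqVneq (mdeg h) (d - i)%N; first by rewrite mulr0.
rewrite (pairing_homog0 hF) ?mulr0 // => m md; rewrite coef_XmM.
case: ifP => // hm; apply: hs; apply: contraNneq ne => mi.
have := congr1 mdeg (submK hm); rewrite mdegD md mi => e.
by apply/eqP; rewrite -[X in (X - _)%N]e addKn.
Qed.

(** The witness is the initial form of [s]: the rest of [s], times a monomial of degree [d - i], has
    order above [d], so the initial form inherits the orthogonality. *)
Lemma annihilator_homog_part d i s (F : dpspace n k) : F \is d.-homog ->
    ord_ge i s -> (forall t, ord_ge (d - i) t -> pairing (t * s) F = 0) ->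
  (i <= d)%N -> exists2 t, t \in annihilator F & ord_ge i.+1 (s - t).
Proof.
move=> hF os s0 le; pose t := FPSeries (fun m => if mdeg m == i then s m else 0).
have ot : ord_ge i.+1 (s - t).
  move=> m; rewrite ltnS leq_eqVlt fpsD_coef fpsN_coef /=.
  by case: eqP => [_ _ | _ /= lt]; rewrite ?subrr // subr0 os.
exists t => //; apply: (@homog_annihilator d i) => // [m /negPf /= -> // | m md].
have -> : t = s - (s - t) by rewrite opprB addrCA subrr addr0.
rewrite mulrBr pairingBl s0; last by rewrite -md; apply: ord_ge_Xm.
rewrite (pairing_homog_ord hF) ?subrr // -(subnK le) -addnS -md.
by apply: ord_geM => //; apply: ord_ge_Xm.
Qed.

Section Apolar.
Variables (F : dpspace n k) (F0 : F != 0).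
Local Notation A := (Apolar F0).
Local Notation filt := (apolar_filt F0).
Local Notation pi := (apolar_pi F0).

Lemma has_hilbert_functionP (H : nat -> nat) : has_hilbert_function A H <->
  forall i, quotient_dim (filt i) (filt i.+1) (H i).
Proof.
split=> [[m [[mmax _] _ Hm]] i | qd]; last first.
  exists (filt 1); split; [exact: apolar_local | exact: apolar_residue_field |].
  by move=> i; rewrite !apolar_ideal_exp.
have em : m = filt 1.
  by apply/funext => x; apply: ((apolar_local F0).2 _ mmax x).
by have := Hm i; rewrite em !apolar_ideal_exp.
Qed.

(** Uniqueness of the coordinates of 0: lifts of a basis stay independent modulo the annihilator and
    higher order. *)
Lemma quotient_dim_free i r : quotient_dim (filt i) (filt i.+1) r ->
  exists2 p : 'I_r -> fpseries n k, forall j, ord_ge i (p j)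
    & forall (c : 'I_r -> k) s, s \in annihilator F ->
        ord_ge i.+1 (\sum_j c j *: p j - s) -> forall j, c j = 0.
Proof.
move=> [e [ei eb]].
have /choice[p pP] j : exists s, ord_ge i s /\ e j = pi s.
  by have /apolar_filtP[s os ->] := ei j; exists s.
exists p => [j | c s sF os j]; first by have [] := pP j.
have [c0 [_ uniq]] : exists! c : 'rV[k]_r, 0 - \sum_j c 0 j *: e j \in filt i.+1.
  by apply: eb; apply/apolar_filtP; exists 0 => //; rewrite apolar_pi0.
have z0 : c0 = 0.
  apply: uniq; apply/apolar_filtP; exists 0 => //.
  by rewrite apolar_pi0 big1 ?subrr // => l _; rewrite mxE scale0r.
have : c0 = \row_l - c l.
  apply: uniq; apply/apolar_filtP; exists (\sum_l c l *: p l - s) => //.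
  have piS : pi s = 0 by apply/apolar_pi_eq0 => t; move/annihilatorP: sF.
  rewrite apolar_piB piS subr0.
  rewrite apolar_pi_sum sub0r -sumrN; apply: eq_bigr => l _.
  by have [_ ->] := pP l; rewrite mxE apolar_piZ scaleNr opprK.
by rewrite z0 => /rowP/(_ j); rewrite !mxE => /eqP; rewrite eq_sym oppr_eq0 => /eqP.
Qed.

(** A dimension count in degree [i]: the [q l] and [r] lifts of a basis of the graded piece
    outnumber the monomials, and in a relation the lifts drop out because the [q l] annihilate [F].
    Thus the annihilator has dimension at most [D - r] in degree [i]. *)
Lemma annihilator_relation i r D N (ms : 'I_D -> 'X_{1..n})
    (q : 'I_N -> fpseries n k) :
    quotient_dim (filt i) (filt i.+1) r ->
    (forall m, mdeg m = i -> exists j, m = ms j) -> (D < N + r)%N ->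
    (forall l, ord_ge i (q l)) -> (forall l, q l \in annihilator F) ->
  exists2 a : 'I_N -> k, exists l, a l != 0 & ord_ge i.+1 (\sum_l a l *: q l).
Proof.
move=> /quotient_dim_free[p op pfree] cover lt oq qF.
pose vec (l : 'I_(N + r)) := match split l with inl a => q a | inr b => p b end.
have vl a : vec (lshift r a) = q a by rewrite /vec (unsplitK (inl a)).
have vr b : vec (rshift N b) = p b by rewrite /vec (unsplitK (inr b)).
have [u [l ul] u0] := linear_relation (fun l j => vec l (ms j)) lt.
have ou : ord_ge i.+1 (\sum_l u l *: vec l).
  move=> m; rewrite ltnS leq_eqVlt => /orP[/eqP/cover[j ->] | lti].
    by rewrite fps_sum_coef; apply: u0.
  have : ord_ge i (\sum_l u l *: vec l); last exact.
  apply: ord_ge_sum => l' _; apply: ord_geZ; rewrite /vec; case: split => a.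
    exact: oq.
  exact: op.
move: ou; rewrite big_split_ord /=.
rewrite (eq_bigr _ (fun a _ => congr1 _ (vl a))) (eq_bigr _ (fun a _ => congr1 _ (vr a))).
set Q := \sum_(a < N) _; set P := \sum_(b < r) _ => ou.
have QF : - Q \in annihilator F.
  apply/annihilatorP => t; rewrite mulrN pairingNl mulr_sumr pairing_suml.
  rewrite big1 ?oppr0 // => a _; rewrite -scalerAr pairingZl.
  by have /annihilatorP-> := qF a; rewrite mulr0.
have ur b : u (rshift N b) = 0.
  by apply: (pfree (fun b => u (rshift N b)) _ QF); rewrite opprK addrC.
exists (fun a => u (lshift r a)).
  move: ul; case: (splitP l) => [a | b] el ul; [exists a | case/eqP: ul].
    by rewrite (_ : lshift r a = l) //; apply: val_inj.
  by rewrite -(ur b); congr u; apply: val_inj.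
suff P0 : P = 0 by move: ou; rewrite P0 addr0.
by rewrite /P big1 // => b _; rewrite ur scale0r.
Qed.

(* Only the pairing of [m ^ i] with [m ^ (d - i)] matters: [p] and [q] are dual
   bases for it. *)
Lemma quotient_dim_dual_bases d i r (p q : 'I_r -> fpseries n k) :
    F \is d.-homog -> (i <= d)%N ->
    (forall j, ord_ge i (p j)) -> (forall l, ord_ge (d - i) (q l)) ->
    (forall j l, pairing (p j * q l) F = (j == l)%:R) ->
    (forall s t, ord_ge i s -> ord_ge (d - i) t ->
       pairing (s * t) F = \sum_l pairing (s * q l) F * pairing (p l * t) F) ->
  quotient_dim (filt i) (filt i.+1) r.
Proof.
move=> hF le op oq pq dual; exists (fun j => pi (p j)); split.
  by move=> j; apply/apolar_filtP; exists (p j).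
move=> v /apolar_filtP[s os ->].
have piE c : \sum_(j < r) c j *: pi (p j) = pi (\sum_j c j *: p j).
  by rewrite apolar_pi_sum; apply: eq_bigr => j _; rewrite apolar_piZ.
have pairE (c : 'I_r -> k) l : pairing ((\sum_j c j *: p j) * q l) F = c l.
  rewrite mulr_suml pairing_suml (bigD1 l) //= -scalerAl pairingZl pq eqxx mulr1.
  rewrite big1 ?addr0 // => j ne; rewrite -scalerAl pairingZl pq.
  by rewrite (negPf ne) mulr0.
exists (\row_l pairing (s * q l) F); split.
  (* [s'] is orthogonal to every [q l], hence by [dual] to all series of order [d - i], and its
     initial form annihilates [F]. *)
  rewrite piE -apolar_piB; set s' := s - _.
  have os' : ord_ge i s'.
    by apply: ord_geB => //; apply: ord_ge_sum => j _; apply: ord_geZ.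
  have [||t tF ot] := annihilator_homog_part hF os'.
  - move=> t ot; rewrite mulrC dual // big1 // => l _.
    rewrite mulrBl pairingBl pairE mxE subrr mul0r //.
  - by [].
  apply/apolar_filtP; exists (s' - t) => //; apply/apolar_pi_eq.
  by rewrite subKr.
move=> c; rewrite piE -apolar_piB => /apolar_filtP[t ot /apolar_pi_eq sF].
apply/rowP => l; rewrite mxE -(pairE (c 0) l); apply/eqP.
rewrite -subr_eq0 -pairingBl -mulrBl.
have -> : s - \sum_j c 0 j *: p j = (s - \sum_j c 0 j *: p j - t) + t by rewrite subrK.
rewrite mulrDl pairingDl [(_ - t) * _]mulrC; have /annihilatorP-> := sF.
rewrite add0r (pairing_homog_ord hF) //.
by rewrite -(subnKC le) -addSn; apply: ord_geM.
Qed.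

End Apolar.
End HilbertFunction.

(** * Orbits of quartics *)

Section Necessity.
Variables (n : nat) (k : fieldType).
Local Notation S := (fpseries n k).

Lemma lrmorphism_inverse (psi : {lrmorphism S -> S}) : bijective psi ->
  exists2 psi' : {lrmorphism S -> S}, cancel psi psi' & cancel psi' psi.
Proof.
case=> g K K'; pose g' : {lrmorphism S -> S} := HB.pack g
  (GRing.isLinear.Build k S S *:%R g (can2_linear K K'))
  (GRing.isMonoidMorphism.Build S S g (can2_monoid_morphism K K')).
by exists g'.
Qed.

(** Moving a unit past a multiplicative map replaces it by its image, so composites and inverses
    keep the form unit times automorphism. *)
Lemma in_G_decomposition (phi : S -> S) : in_G phi ->
  exists u v (psi : {lrmorphism S -> S}),
    [/\ v * u = 1, bijective psi & forall s, phi s = u * psi s].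
Proof.
apply: (in_G_ind (P := fun phi => exists u v (psi : {lrmorphism S -> S}),
    [/\ v * u = 1, bijective psi & forall s, phi s = u * psi s])).
- by move=> {}phi bphi; exists 1, 1, phi; split=> // [|s]; rewrite mul1r.
- move=> u v vu; exists u, v, idfun; split=> //; exact: (Bijective (fun _ => erefl) (fun _ => erefl)).
- move=> {}phi psi _ [u1 [v1 [f1 [vu1 b1 E1]]]] _ [u2 [v2 [f2 [vu2 b2 E2]]]].
  exists (u1 * f1 u2), (v1 * f1 v2), (f1 \o f2); split.
  + by rewrite mulrACA vu1 mul1r -rmorphM vu2 rmorph1.
  + exact: bij_comp.
  + by move=> s; rewrite /= E1 E2 rmorphM mulrA.
- move=> {}phi psi _ [u [v [f [vu bf E]]]] K K'.
  have [f' fK fK'] := lrmorphism_inverse bf.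
  exists (f' v), (f' u), f'; split.
  + by rewrite -rmorphM mulrC vu rmorph1.
  + by exists f.
  + move=> s; rewrite -rmorphM -{2}(K' s) E mulrA vu mul1r; apply/esym/fK.
Qed.

(** If a variable had an image with constant term [c != 0], then the unit obtained by subtracting
    [c] from the variable would be sent to a series without constant term. *)
Lemma automorphism_preserves_order (psi : {lrmorphism S -> S}) :
  bijective psi -> preserves_order psi.
Proof.
move=> bpsi; apply: lrmorphism_preserves_order => i; apply/ord_ge1P.
set s := fpsXm _ _; have s0 : s 0%MM = 0 by rewrite fpsXm_coef eq_sym mnm1_eq0.
apply/eqP/negPn/negP => nz; pose c := (psi s) 0%MM.
have [t ts] : exists t, t * (s - c%:A) = 1.
  apply: fps_unit.
  by rewrite fpsD_coef fpsN_coef fpsZ_coef fps1_coef eqxx mulr1 s0 sub0r oppr_eq0.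
have o1 : ord_ge 1 (1 : S).
  rewrite -(rmorph1 psi) -ts rmorphM rmorphB /= rmorph_alg.
  by apply: ord_geMl; apply: ord_ge_const.
by have /ord_ge1P/eqP := o1; rewrite fps1_coef eqxx oner_eq0.
Qed.

(** The linear part [l'] of the image of [l] again has a square annihilating [F]. Up to order 5 the
    cube of the image is a multiple of that square, so [l ^+ 3] is orthogonal to [F + C], and it is
    orthogonal to [F] as well. *)
Lemma orbit_square_obstruction (F C : dpspace n k) (c : 'rV[k]_n) :
    F \is 4.-homog -> (msize C <= 4)%N -> G_orbit F (F + C) ->
    linear_form c ^+ 2 \in annihilator F ->
  pairing (linear_form c ^+ 3) C = 0.
Proof.
move=> hF sC [phi /in_G_decomposition[u [v [psi [vu bpsi phiE]]]] dual].
set l := linear_form c => lF.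
have [psi' K K'] := lrmorphism_inverse bpsi.
have po := automorphism_preserves_order bpsi.
have po' : preserves_order psi' by apply: automorphism_preserves_order; exists psi.
pose m := psi l; have om : ord_ge 1 m by apply/po/ord_ge_linear_form.
(* [C] is not seen here: [l ^+ 2] times a series of order 2 has order 4, above the degree of [C]. *)
have m2 t : ord_ge 2 t -> pairing (m ^+ 2 * t) F = 0.
  move=> ot; have -> : m ^+ 2 * t = phi (l ^+ 2 * psi' (v * t)).
    by rewrite phiE rmorphM rmorphXn /= K' mulrCA [u * (_ * _)]mulrA [u * v]mulrC vu mul1r.
  rewrite -dual pairingDr mulrC.
  have /annihilatorP-> := lF; rewrite add0r (pairing_ord_ge sC) //.
  rewrite mulrC; apply: (@ord_geM _ _ 2); last exact/po'/ord_geMl.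
  exact/ord_geX/ord_ge_linear_form.
pose l' := linear_form (linear_part m); pose Q := m - l'.
have oQ : ord_ge 2 Q by apply: ord_ge_linear_part.
have ol' : ord_ge 1 l' by apply: ord_ge_linear_form.
have mE : m = l' + Q by rewrite addrC subrK.
have l'F : l' ^+ 2 \in annihilator F.
  apply: (homog_annihilator (i := 2) hF) => // [|h dh].
    by rewrite expr2; apply: (@fps_homogM _ _ 1 1); apply: fps_homog_linear_form.
  have oh : ord_ge 2 (fpsXm k h) by rewrite -[2%N]/(4 - 2)%N -dh; apply: ord_ge_Xm.
  have -> : fpsXm k h * l' ^+ 2 = m ^+ 2 * fpsXm k h - fpsXm k h * (Q * (l' + m)).
    by rewrite mE; ring.
  rewrite pairingBl m2 // (pairing_homog_ord hF) ?subrr //.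
  apply: (@ord_geM _ _ 2 3) => //; apply: (@ord_geM _ _ 2 1) => //.
  exact: ord_geD.
have : pairing (phi (l ^+ 3)) F = 0.
  (* The terms of [(l' + Q) ^+ 3] not divisible by [l' ^+ 2] contain [Q ^+ 2] and have order at
     least 5. *)
  have -> : phi (l ^+ 3) = (u * (m + 2%:R * Q)) * l' ^+ 2
      + u * ((2%:R * l' + m) * Q ^+ 2).
    by rewrite phiE rmorphXn /= -/m mE; ring.
  rewrite pairingDl; have /annihilatorP-> := l'F.
  rewrite add0r (pairing_homog_ord hF) //; apply: ord_geMl.
  apply: (@ord_geM _ _ 1 4); last by apply: (@ord_geM _ _ 2 2).
  by apply: ord_geD => //; apply: ord_geMl.
rewrite -dual pairingDr exprS; have /annihilatorP-> := lF.
by rewrite add0r -exprS.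
Qed.

(** The obstruction is tested on the divided cubes of the variables, where [l ^+ 3] takes the values
    [c 0 i ^+ 3], with no multinomial factor. *)
Lemma orbit_square_free (F : dpspace n k) :
    F \is 4.-homog ->
    (forall C : dpspace n k, (msize C <= 4)%N -> G_orbit F (F + C)) ->
  forall c : 'rV[k]_n, c != 0 -> contract (linear_form c ^+ 2) F != 0.
Proof.
move=> hF orb c; apply: contraNneq => lF; apply/eqP/rowP => i; rewrite mxE.
have sC : (msize ('X_[(U_(i) *+ 3)%MM] : dpspace n k) <= 4)%N.
  by rewrite mmeasureX /= mdegMn mdeg1.
have := orbit_square_obstruction hF sC (orb _ sC) (introT eqP lF).
rewrite pairingX.
have coefX d : (linear_form c ^+ d) (U_(i) *+ d)%MM = c 0 i ^+ d.
  elim: d => [|d IH]; first by rewrite expr0 fps1_coef mulm0n eqxx.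
  rewrite exprS mulr_suml fps_sum_coef (bigD1 i) // big1 => [|j ne].
    rewrite Monoid.mulm1 -scalerAl fpsZ_coef coef_linM mulmnE mnm1E eqxx /= mulmS.
    by rewrite addmC addmK IH exprS.
  by rewrite -scalerAl fpsZ_coef coef_linM mulmnE mnm1E eq_sym (negPf ne) mulr0.
by rewrite coefX => /eqP; rewrite expf_eq0 => /andP[_ /eqP].
Qed.

End Necessity.

(** * Sufficiency: removing terms of lower degree *)

Section Sufficiency.
Variables (n : nat) (k : fieldType).
Local Notation S := (fpseries n k).
Local Notation X i := (fpsXm k U_(i)%MM).
Implicit Types (F C : dpspace n k) (m h : 'X_{1..n}) (d e : nat).

Lemma ord_ge_Xm_mdeg d m : mdeg m = d -> ord_ge d (fpsXm k m).
Proof. by move=> <-; apply: ord_ge_Xm. Qed.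

Lemma msize_leP d (f : dpspace n k) :
  (forall m, (d <= mdeg m)%N -> f@_m = 0) -> (msize f <= d)%N.
Proof.
move=> f0; rewrite mmeasureE; apply/bigmax_leqP_seq => m mf _.
rewrite ltnNge; apply/negP => /f0/eqP.
by rewrite mcoeff_eq0 mf.
Qed.

Lemma msize_coef0 d (f : dpspace n k) m :
  (msize f <= d)%N -> (d <= mdeg m)%N -> f@_m = 0.
Proof.
by move=> sf dm; apply: memN_msupp_eq0; apply: contraTN dm => /msize_mdeg_lt; lia.
Qed.

(** [phi - id] sends a monomial of degree above [d] beyond the degree of [F], and one of degree at
    least [d] beyond that of [C]; only degree [d] is left to compare. As [msize] is the degree plus
    one, [C] has degree at most [d], and [C'] less than [d]. *)
Lemma orbit_lower F C (phi : {lrmorphism S -> S}) d e :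
    F \is (d + e).-homog -> (0 < e)%N ->
    (forall i, ord_ge e.+1 (phi (X i) - X i)) ->
    (msize C <= d.+1)%N ->
    (forall m, mdeg m = d -> pairing (phi (fpsXm k m) - fpsXm k m) F = - C@_m) ->
  exists2 C', (msize C' <= d)%N & G_orbit (F + C) (F + C').
Proof.
move=> hF e0 phiX sC phiC.
have ni d' s := @near_identity _ _ phi _ phiX d' s.
have bphi : bijective phi.
  apply: raises_order_bij => d' s /ni; apply: ord_geW; lia.
have [g gE] := dual_image_exists (F + C) (near_identity_preserves phiX).
exists (g - F).
  apply: msize_leP => m dm; rewrite mcoeffB -pairing_Xm gE.
  have on := ni _ _ (@ord_ge_Xm n k m).
  change (pairing (phi (fpsXm k m)) (F + C) - F@_m = 0).
  rewrite -(subrK (fpsXm k m) (phi (fpsXm k m))) pairingDl pairing_Xm mcoeffD pairingDr.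
  rewrite [pairing _ C](pairing_ord_ge sC) ?addr0; last by apply: ord_geW on; lia.
  case: (ltngtP d (mdeg m)) dm => // [lt _ | ed _].
    rewrite (pairing_homog_ord hF) ?(msize_coef0 sC) // ?addr0 ?add0r ?subrr //.
    by apply: ord_geW on; lia.
  by rewrite phiC //; ring.
exists phi; first exact: in_G_aut.
by move=> s; rewrite addrC subrK.
Qed.

(** Automorphisms fix 1 and with it the constant coefficient. The unit [1 + r] changes that
    coefficient alone, since [r] is a multiple of a monomial of top degree. *)
Lemma orbit_constant F C d :
  F != 0 -> F \is d.+1.-homog -> (msize C <= 1)%N -> G_orbit F (F + C).
Proof.
move=> F0 hF sC; set m := mlead F; have Fm : F@_m != 0 := mlead_coef_neq0 F0.
have dm : mdeg m = d.+1 by apply: (dhomog_mf hF); apply: mlead_supp.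
have om : ord_ge d.+1 (fpsXm k m) by rewrite -dm; apply: ord_ge_Xm.
pose r := (C@_0%MM / F@_m) *: fpsXm k m.
have or : ord_ge d.+1 r by apply: ord_geZ.
have [t tu] : exists t, t * (1 + r) = 1.
  apply: fps_unit; rewrite fpsD_coef or ?mdeg0 // addr0 fps1_coef eqxx.
  exact: oner_neq0.
exists (fun s => (1 + r) * s); first exact: in_G_unit tu.
move=> s; rewrite pairingDr mulrDl mul1r pairingDl; congr (_ + _).
rewrite /r -scalerAl pairingZl (pairing_top F0).
rewrite [_ * F@_ _]mulrC mulrA divfK // mulrC.
have lt0 : (mdeg (0%MM : 'X_{1..n}) < 1)%N by rewrite mdeg0.
rewrite (pairingwE _ sC) (bigD1 (BMultinom lt0)) //= big1 ?addr0 // => h ne; case/negP: ne; apply/eqP/val_inj => /=.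
by apply/eqP; rewrite -mdeg_eq0 -leqn0 -ltnS bmdeg.
Qed.

Lemma automorphism_of_perturbation e (D : 'I_n -> S) :
    (forall i, ord_ge e.+1 (D i)) ->
  exists phi : {lrmorphism S -> S}, forall i, phi (X i) = X i + D i.
Proof.
move=> oD; apply: fps_substitution => i; apply: ord_geD; last exact: ord_geW (oD i).
by rewrite -(mdeg1 i); apply: ord_ge_Xm.
Qed.

Lemma mdeg1E m : mdeg m = 1%N -> exists i, m = U_(i)%MM.
Proof. by move/eqP/mdeg1P => [i /eqP]; exists i. Qed.

Lemma mdegSE d m : mdeg m = d.+1 -> exists i m', m = (U_(i) + m')%MM /\ mdeg m' = d.
Proof.
move=> dm; have /existsP[i nz] : [exists i : 'I_n, m i != 0%N].
  apply: contraPT dm; rewrite negb_exists => /forallP m0.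
  suff -> : m = 0%MM by rewrite mdeg0.
  by apply/mnmP => i; rewrite mnm0E; move/negPn/eqP: (m0 i).
exists i, (m - U_(i))%MM; have E : (m - U_(i) + U_(i))%MM = m by rewrite submK ?lep1mP.
split; first by rewrite addmC.
by have := congr1 mdeg E; rewrite mdegD mdeg1 dm addn1 => -[].
Qed.

Lemma orbit_lower1 F C : F != 0 -> F \is 4.-homog -> (msize C <= 2)%N ->
  exists2 C', (msize C' <= 1)%N & G_orbit (F + C) (F + C').
Proof.
move=> F0 hF sC; set m := mlead F; have Fm : F@_m != 0 := mlead_coef_neq0 F0.
have dm : mdeg m = 4%N by apply: (dhomog_mf hF); apply: mlead_supp.
(* Any series of order 4 with the prescribed pairing will do; a multiple of a monomial occurring in
   [F] is the simplest. *)
pose D i := (- C@_U_(i) / F@_m) *: fpsXm k m.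
have oD i : ord_ge 4 (D i) by apply: ord_geZ; rewrite -dm; apply: ord_ge_Xm.
have [phi phiX] := automorphism_of_perturbation oD.
apply: (@orbit_lower _ _ phi 1 3) => // [i | m' /mdeg1E[i ->]].
  by rewrite phiX addrAC subrr add0r.
by rewrite phiX addrAC subrr add0r pairingZl pairing_Xm divfK.
Qed.

(** The equations are [<D_i X_j + D_j X_i, F> = - C_ij]. Giving each summand half of the right-hand
    side decouples them into one system for each [i], whose obstruction [w] is a linear form
    annihilating [F]. *)
Lemma orbit_lower2 F C : F \is 4.-homog -> (2%:R : k) != 0 ->
    (forall c : 'rV[k]_n, linear_form c \in annihilator F -> c = 0) ->
    (msize C <= 3)%N ->
  exists2 C', (msize C' <= 2)%N & G_orbit (F + C) (F + C').
Proof.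
move=> hF two_neq0 ann1 sC.
have ex i : exists D, ord_ge 3 D /\
    forall j, pairing (D * X j) F = - C@_(U_(i) + U_(j)) / 2%:R.
  have [w|u uE] := @fredholm k 'X_{1..n < 4} 'I_n
    (fun (h : 'X_{1..n < 4}) j => if mdeg h == 3%N then pairing (fpsXm k h * X j) F else 0)
    (fun j => - C@_(U_(i) + U_(j)) / 2%:R).
    move=> w0; suff w0' : \row_j w j = 0.
      rewrite big1 // => j _; have /rowP/(_ j) := w0'.
      by rewrite !mxE => ->; rewrite mulr0.
    apply: ann1; apply: (homog_annihilator (i := 1) hF) => //.
      exact: fps_homog_linear_form.
    move=> m dm; have ltm : (mdeg m < 4)%N by rewrite dm.
    rewrite -[RHS](w0 (BMultinom ltm)) /linear_form mulr_sumr pairing_suml.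
    apply: eq_bigr => j _; rewrite mxE -scalerAr pairingZl mulrC /= dm eqxx //.
  exists (\sum_(h : 'X_{1..n < 4} | mdeg h == 3%N) u h *: fpsXm k h); split.
    apply: ord_ge_sum => h /eqP dh; apply: ord_geZ; exact: ord_ge_Xm_mdeg.
  move=> j; rewrite -uE mulr_suml pairing_suml big_mkcond /=; apply: eq_bigr => h _.
  by case: ifP => _; rewrite ?mulr0 // -scalerAl pairingZl.
have [D DP] := choice ex; have oD i : ord_ge 3 (D i) by have [] := DP i.
have [phi phiX] := automorphism_of_perturbation oD.
apply: (@orbit_lower _ _ phi 2 2) => // [i | m].
  by rewrite phiX addrAC subrr add0r.
move=> /mdegSE[i [m' [-> /mdeg1E[j ->]]]].
rewrite fpsXmD rmorphM /= !phiX.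
have -> : (X i + D i) * (X j + D j) - X i * X j
  = D i * X j + D j * X i + D i * D j by ring.
rewrite !pairingDl (DP i).2 (DP j).2 addmC.
rewrite (pairing_homog_ord hF); last first.
  by apply: (@ord_geW _ _ (3 + 3)) => //; apply: ord_geM.
by field.
Qed.

Lemma sum_triple (I : finType) (f : I * I * I -> k) :
  \sum_p f p = \sum_i \sum_j \sum_l f (i, j, l).
Proof. by rewrite !pair_bigA /=; apply: eq_bigr => -[[i j] l]. Qed.

(** Here the sum of three terms [<D_x X_y X_z, F>] is prescribed. The terms cannot be prescribed one
    by one, as quadrics may annihilate [F], so all [D_x] come from a single system indexed by
    ordered triples. *)
Lemma orbit_lower3 F C : F \is 4.-homog -> (2%:R : k) != 0 -> (3%:R : k) != 0 ->
    (forall T : 'I_n -> 'I_n -> 'I_n -> k,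
       (forall x y z, T x y z = T y x z) -> (forall x y z, T x y z = T x z y) ->
       (forall x, \sum_y X y * linear_form (\row_z T x y z) \in annihilator F) ->
       forall x y z, T x y z = 0) ->
    (msize C <= 4)%N ->
  exists2 C', (msize C' <= 3)%N & G_orbit (F + C) (F + C').
Proof.
move=> hF two_neq0 three_neq0 ann2 sC.
pose c x y z := - C@_(U_(x) + (U_(y) + U_(z))).
have c23 x y z : c x y z = c x z y by rewrite /c [(U_(y) + _)%MM]addmC.
have c12 x y z : c x y z = c y x z by rewrite /c !addmA [(U_(x) + _)%MM]addmC.
(* Row [p] stands for perturbing the variable [p.1] by the monomial [p.2], column [q] for a cubic
   monomial as an ordered triple; rows of degree below 2 are set to zero. *)
pose a (p : 'I_n * 'X_{1..n < 3}) (q : 'I_n * 'I_n * 'I_n) : k :=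
  let g y z := if mdeg p.2 == 2%N then pairing (fpsXm k p.2 * (X y * X z)) F else 0 in
  (q.1.1 == p.1)%:R * g q.1.2 q.2 + (q.1.2 == p.1)%:R * g q.1.1 q.2
  + (q.2 == p.1)%:R * g q.1.1 q.1.2.
have delta (x : 'I_n) (f : 'I_n -> k) : \sum_i (i == x)%:R * f i = f x.
  rewrite (bigD1 x) //= eqxx mul1r big1 ?addr0 // => i /negPf ->.
  by rewrite mul0r.
have [w|u uE] := @fredholm k _ _ a (fun q => c q.1.1 q.1.2 q.2).
  move=> w0; pose W x y z := w (x, y, z).
  (* The symmetrization of [w]; the slices of [T] are quadrics annihilating [F]. *)
  pose T x y z := W x y z + W y x z + W y z x + (W x z y + W z x y + W z y x).
  have T12 x y z : T x y z = T y x z by rewrite /T; ring.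
  have T23 x y z : T x y z = T x z y by rewrite /T; ring.
  have /(ann2 _ T12 T23) T0 x : \sum_y X y * linear_form (\row_z T x y z) \in annihilator F.
    apply: (homog_annihilator (i := 2) hF) => //.
      apply: fps_homog_sum => y _; apply: (@fps_homogM _ _ 1 1).
        by have := @fps_homog_Xm n k U_(y)%MM; rewrite mdeg1.
      exact: fps_homog_linear_form.
    move=> m dm; have ltm : (mdeg m < 3)%N by rewrite dm.
    pose g y z := pairing (fpsXm k m * (X y * X z)) F.
    have gC y z : g y z = g z y by rewrite /g [X y * _]mulrC.
    transitivity (\sum_y \sum_z T x y z * g y z).
      rewrite mulr_sumr pairing_suml; apply: eq_bigr => y _.
      rewrite /linear_form !mulr_sumr pairing_suml; apply: eq_bigr => z _.
      by rewrite mxE -!scalerAr pairingZl.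
    (* This is row [(x, m)] of the homogeneous system: each of the three positions of [x]
       contributes one term. *)
    have H : \sum_y \sum_z (W x y z + W y x z + W y z x) * g y z = 0.
      rewrite -[RHS](w0 (x, BMultinom ltm)) sum_triple /a /= dm eqxx -/g.
      transitivity (\sum_i \sum_j \sum_l ((i == x)%:R * (g j l * W i j l)
        + ((j == x)%:R * (g i l * W i j l) + (l == x)%:R * (g i j * W i j l)))); last first.
        apply: eq_bigr => i _; apply: eq_bigr => j _; apply: eq_bigr => l _.
        by rewrite -/(W i j l) /g; ring.
      under [RHS]eq_bigr => i _.
        under eq_bigr => j _ do rewrite !big_split /= -!mulr_sumr delta.
        rewrite !big_split /= -!mulr_sumr delta.
        over.
      rewrite !big_split /= delta -!big_split /=; apply: eq_bigr => y _.
      rewrite -!big_split /=; apply: eq_bigr => z _; ring.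
    transitivity (\sum_y \sum_z (W x y z + W y x z + W y z x) * g y z
        + \sum_y \sum_z (W x z y + W z x y + W z y x) * g z y); last first.
      by rewrite [Z in _ + Z]exchange_big H addr0.
    rewrite -big_split; apply: eq_bigr => y _; rewrite -big_split.
    by apply: eq_bigr => z _; rewrite [g z y]gC /T /=; ring.
  pose Sg f := \sum_x \sum_y \sum_z c x y z * f x y z : k.
  have Sg23 f : Sg (fun x y z => f x z y) = Sg f.
    apply: eq_bigr => x _; rewrite exchange_big; apply: eq_bigr => y _.
    by apply: eq_bigr => z _; rewrite c23.
  have Sg12 f : Sg (fun x y z => f y x z) = Sg f.
    rewrite /Sg exchange_big; apply: eq_bigr => x _; apply: eq_bigr => y _.
    by apply: eq_bigr => z _; rewrite c12.
  (* By symmetry of [c], all six permutations of [W] have the same sum against it. *)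
  have SgT : Sg T = 2%:R * 3%:R * Sg W.
    have E : Sg T = Sg W + Sg (fun x y z => W y x z) + Sg (fun x y z => W y z x)
      + (Sg (fun x y z => W x z y) + Sg (fun x y z => W z x y)
         + Sg (fun x y z => W z y x)).
      rewrite /Sg -!big_split; apply: eq_bigr => x _; rewrite -!big_split.
      apply: eq_bigr => y _; rewrite -!big_split; apply: eq_bigr => z _.
      by rewrite /T /=; ring.
    have E1 := Sg23 W; have E2 := Sg12 W.
    have E3 := Sg12 (fun x y z => W x z y).
    have E4 := Sg23 (fun x y z => W y x z).
    have E5 := Sg12 (fun x y z => W z x y).
    by rewrite E E5 E3 E4 E1 E2; ring.
  rewrite sum_triple -/(Sg W); apply: (mulfI (mulf_neq0 two_neq0 three_neq0)).
  rewrite -SgT mulr0; apply: big1 => x _; apply: big1 => y _; apply: big1 => z _.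
  by rewrite T0 mulr0.
pose D x := \sum_(h : 'X_{1..n < 3} | mdeg h == 2%N) u (x, h) *: fpsXm k h.
have oD x : ord_ge 2 (D x).
  by apply: ord_ge_sum => h /eqP dh; apply: ord_geZ; apply: ord_ge_Xm_mdeg.
have DP x y z : pairing (D x * (X y * X z)) F + pairing (D y * (X x * X z)) F
    + pairing (D z * (X x * X y)) F = c x y z.
  rewrite -(uE (x, y, z)).
  have DE t r s : pairing (D t * (X r * X s)) F = \sum_i \sum_(h : 'X_{1..n < 3})
      u (i, h) * ((t == i)%:R *
         if mdeg h == 2%N then pairing (fpsXm k h * (X r * X s)) F else 0).
    rewrite (bigD1 t) //= [Z in _ + Z]big1 ?addr0 => [|i ne]; last first.
      by apply: big1 => h _; rewrite eq_sym (negPf ne) mul0r mulr0.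
    rewrite mulr_suml pairing_suml big_mkcond /=; apply: eq_bigr => h _.
    by rewrite eqxx mul1r; case: ifP => _; rewrite ?mulr0 // -scalerAl pairingZl.
  transitivity (\sum_i \sum_(h : 'X_{1..n < 3}) u (i, h) * a (i, h) (x, y, z)).
    rewrite !DE -!big_split; apply: eq_bigr => i _; rewrite -!big_split.
    by apply: eq_bigr => h _; rewrite /a /=; ring.
  by rewrite pair_bigA; apply: eq_bigr => -[i h] _.
have [phi phiX] := automorphism_of_perturbation oD.
apply: (@orbit_lower _ _ phi 3 1) => // [i | m].
  by rewrite phiX addrAC subrr add0r.
move=> /mdegSE[x [m' [-> /mdegSE[y [m'' [-> /mdeg1E[z ->]]]]]]].
rewrite !fpsXmD !rmorphM /= !phiX.
(* The last bracket collects products of at least two perturbations; its order is at least 5, out of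
   reach of [F]. *)
have -> : (X x + D x) * ((X y + D y) * (X z + D z)) - X x * (X y * X z)
  = D x * (X y * X z) + D y * (X x * X z) + D z * (X x * X y)
    + (D x * D y * (X z + D z) + (D x * X y + X x * D y) * D z) by ring.
have oX (i : 'I_n) : ord_ge 1 (X i) by apply: ord_ge_Xm_mdeg; rewrite mdeg1.
rewrite pairingDl [Z in _ + Z](pairing_homog_ord hF) ?addr0.
  by rewrite !pairingDl DP.
apply: ord_geD; first apply: (@ord_geM _ _ 4 1).
- exact: (@ord_geM _ _ 2 2).
- by apply: ord_geD => //; apply: ord_geW (oD z).
apply: (@ord_geM _ _ 3 2) => //; apply: ord_geD; first exact: (@ord_geM _ _ 2 1).
exact: (@ord_geM _ _ 1 2).
Qed.

End Sufficiency.

(** * Ternary quartics with H(1) = 3 and H(2) = 4 *)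

Section Quartics.
Variable k : closedFieldType.
Local Notation X i := (fpsXm k U_(i)%MM).
Variable F : dpspace 3 k.
Hypothesis F0 : F != 0.
Hypothesis hF : F \is 4.-homog.
Hypothesis H1 : quotient_dim (apolar_filt F0 1) (apolar_filt F0 2) 3.
Hypothesis H2 : quotient_dim (apolar_filt F0 2) (apolar_filt F0 3) 4.

(** Three basis lifts and one annihilating form exceed the three linear monomials. *)
Lemma linear_annihilator0 (c : 'rV[k]_3) : linear_form c \in annihilator F -> c = 0.
Proof.
move=> cF; have [||||a [l al] oa] := @annihilator_relation _ _ _ _ 1 3 3 1
  (fun j => U_(j)%MM) (fun=> linear_form c) H1.
- by move=> m /mdeg1E[i ->]; exists i.
- by [].
- by move=> _; apply: ord_ge_linear_form.
- by [].
apply/rowP => i; rewrite mxE; apply/eqP.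
have := oa U_(i)%MM; rewrite mdeg1 => /(_ isT) /eqP.
rewrite big_ord1 fpsZ_coef linear_formU mulf_eq0 => /orP[|//].
by rewrite (ord1 l) in al; rewrite (negPf al).
Qed.

(** For a symmetric tensor [T] the forms [quadric (T x)] are, up to a common factor, the partial
    derivatives of the cubic defined by [T]. *)
Definition quadric (N : 'I_3 -> 'I_3 -> k) :=
  \sum_y X y * linear_form (\row_z N y z).

Lemma coef_quadric N y z :
  quadric N (U_(y) + U_(z))%MM = if y == z then N y z else N y z + N z y.
Proof.
have term j : (X j * linear_form (\row_l N j l)) (U_(y) + U_(z))%MM
    = if j == y then N y z else if j == z then N z y else 0.
  rewrite coef_linM mnmDE !mnm1E ![_ == j]eq_sym.
  case: (j =P y) => [-> | _]; first by rewrite addmC addmK linear_formU mxE.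
  by case: (j =P z) => [-> | _] //; rewrite addmK linear_formU mxE.
rewrite fps_sum_coef (eq_bigr _ (fun j _ => term j)) (bigD1 y) // eqxx.
case: (y =P z) => [<- | /eqP ne].
  by rewrite big1 => [|j /negPf -> //]; apply: addr0.
have -> : \sum_(i | i != y) (if i == y then N y z else if i == z then N z y else 0) = N z y.
  rewrite (bigD1 z) /=; last by rewrite eq_sym.
  rewrite eqxx [z == y]eq_sym (negPf ne) big1 ?addr0 // => j.
  by case/andP=> /negPf -> /negPf ->.
by [].
Qed.

Lemma quadric_sum (v : 'I_3 -> k) (T : 'I_3 -> 'I_3 -> 'I_3 -> k) :
  \sum_x v x *: quadric (T x) = quadric (fun y z => \sum_x v x * T x y z).
Proof.
rewrite /quadric; under eq_bigr => x _ do rewrite scaler_sumr.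
rewrite exchange_big /=; apply: eq_bigr => y _.
under eq_bigr => x _ do rewrite scalerAr; rewrite -mulr_sumr; congr (_ * _).
rewrite /linear_form; under eq_bigr => x _ do rewrite scaler_sumr.
rewrite exchange_big /=; apply: eq_bigr => z _; rewrite mxE scaler_suml.
by apply: eq_bigr => x _; rewrite mxE scalerA.
Qed.

Lemma quadric_square (c : 'I_3 -> k) :
  quadric (fun y z => c y * c z) = linear_form (\row_z c z) ^+ 2.
Proof.
rewrite expr2 [in RHS]/linear_form mulr_suml; apply: eq_bigr => y _.
rewrite mxE -scalerAl scalerAr; congr (_ * _).
rewrite /linear_form scaler_sumr; apply: eq_bigr => z _.
by rewrite !mxE scalerA.
Qed.

Lemma mdeg2_cover (m : 'X_{1..3}) : mdeg m = 2%N -> exists j : 'I_6,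
  m = nth 0%MM [:: U_(o0) + U_(o0); U_(o0) + U_(o1); U_(o0) + U_(o2);
                   U_(o1) + U_(o1); U_(o1) + U_(o2); U_(o2) + U_(o2)]%MM j.
Proof.
move=> /mdegSE[x [m' [-> /mdeg1E[y ->]]]].
move: x y; apply: ord3P; apply: ord3P.
- by exists (@Ordinal 6 0 isT).
- by exists (@Ordinal 6 1 isT).
- by exists (@Ordinal 6 2 isT).
- by exists (@Ordinal 6 1 isT); rewrite addmC.
- by exists (@Ordinal 6 3 isT).
- by exists (@Ordinal 6 4 isT).
- by exists (@Ordinal 6 2 isT); rewrite addmC.
- by exists (@Ordinal 6 4 isT); rewrite addmC.
- by exists (@Ordinal 6 5 isT).
Qed.

Hypothesis two_neq0 : (2%:R : k) != 0.
Hypothesis square_free :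
  forall c : 'rV[k]_3, c != 0 -> contract (linear_form c ^+ 2) F != 0.

(** Three slices of [T] and four basis lifts exceed the six quadratic monomials, so the slices are
    dependent. The polar square that follows is a combination of slices, hence annihilates [F],
    against [square_free]. *)
Lemma polar_annihilator0 (T : 'I_3 -> 'I_3 -> 'I_3 -> k) :
    (forall x y z, T x y z = T y x z) -> (forall x y z, T x y z = T x z y) ->
    (forall x, quadric (T x) \in annihilator F) ->
  forall x y z, T x y z = 0.
Proof.
move=> T12 T23 TF x y z; apply/eqP/negPn/negP => nz.
have oq N : ord_ge 2 (quadric N).
  apply: ord_ge_sum => j _; apply: (@ord_geM _ _ 1 1).
    by apply: ord_ge_Xm_mdeg; rewrite mdeg1.
  exact: ord_ge_linear_form.
have [//|x'|//|a anz oa] := @annihilator_relation _ _ _ _ 2 4 6 3 _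
  (fun x => quadric (T x)) H2 mdeg2_cover; first exact: oq.
(* Off the diagonal a quadric has twice the matrix entry as coefficient, hence the division by 2. *)
have Ta u v : \sum_x a x * T x u v = 0.
  have sN : \sum_x a x * T x u v = \sum_x a x * T x v u.
    by apply: eq_bigr => i _; rewrite T23.
  have := oa (U_(u) + U_(v))%MM; rewrite mdegD !mdeg1 quadric_sum coef_quadric.
  move/(_ isT); case: ifP => // _; rewrite -sN -mulr2n -mulr_natl => /eqP.
  by rewrite mulf_eq0 (negPf two_neq0) => /eqP.
have [|v [c [[i ci] vc]]] := degenerate_cubic_polar_square T12 T23 anz Ta.
  by exists x, y, z.
have c0 : \row_z c z != 0.
  by apply: contraNneq ci => /rowP/(_ i); rewrite !mxE => ->.
case/negP: (square_free c0); rewrite -[_ == 0]/(_ \in annihilator F).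
rewrite -quadric_square; apply/annihilatorP => t.
have <- : \sum_x v x *: quadric (T x) = quadric (fun y z => c y * c z).
  rewrite quadric_sum; congr quadric.
  by apply/funext => u; apply/funext => w; apply: vc.
rewrite mulr_sumr pairing_suml big1 // => j _; rewrite -scalerAr pairingZl.
by have /annihilatorP-> := TF j; rewrite mulr0.
Qed.

Lemma square_free_orbit (C : dpspace 3 k) : (3%:R : k) != 0 ->
  (msize C <= 4)%N -> G_orbit F (F + C).
Proof.
move=> three_neq0 sC.
have [C3 s3 /G_orbit_sym G3] :=
  orbit_lower3 hF two_neq0 three_neq0 polar_annihilator0 sC.
have [C2 s2 /G_orbit_sym G2] := orbit_lower2 hF two_neq0 linear_annihilator0 s3.
have [C1 s1 /G_orbit_sym G1] := orbit_lower1 F0 hF s2.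
apply: G_orbit_trans G3; apply: G_orbit_trans G2; apply: G_orbit_trans G1.
exact: orbit_constant F0 hF s1.
Qed.

End Quartics.

(** * An infinite family of apolar algebras *)

Section QuarticFamily.
Variable k : fieldType.
Local Notation S := (fpseries 3 k).
Local Notation X i := (fpsXm k U_(i)%MM).
Implicit Types (s t : S) (u v w z : 'rV[k]_3).

Definition mon (a b c : nat) : 'X_{1..3} :=
  (U_(o0) *+ a + (U_(o1) *+ b + U_(o2) *+ c))%MM.

Lemma mdeg_mon a b c : mdeg (mon a b c) = (a + (b + c))%N.
Proof. by rewrite !mdegD !mdegMn !mdeg1 !mul1n. Qed.

Lemma monE a b c i :
  mon a b c i = ((o0 == i) * a + ((o1 == i) * b + (o2 == i) * c))%N.
Proof. by rewrite !mnmDE !mulmnE !mnm1E. Qed.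

Lemma coef_linear_formM u t a b c : (linear_form u * t) (mon a b c) =
  (if a is a'.+1 then u 0 o0 * t (mon a' b c) else 0)
  + (if b is b'.+1 then u 0 o1 * t (mon a b' c) else 0)
  + (if c is c'.+1 then u 0 o2 * t (mon a b c') else 0).
Proof.
rewrite mulr_suml fps_sum_coef sum_ord3 -!scalerAl !fpsZ_coef !coef_linM !monE /=.
rewrite !mul1n !mul0n !add0n !addn0; congr (_ + _ + _).
- case: a => [|a] /=; rewrite ?mulr0 //; congr (_ * t _).
  by apply/mnmP; apply: ord3P; rewrite mnmBE !monE mnm1E /=; lia.
- case: b => [|b] /=; rewrite ?mulr0 //; congr (_ * t _).
  by apply/mnmP; apply: ord3P; rewrite mnmBE !monE mnm1E /=; lia.
- case: c => [|c] /=; rewrite ?mulr0 //; congr (_ * t _).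
  by apply/mnmP; apply: ord3P; rewrite mnmBE !monE mnm1E /=; lia.
Qed.

Variable lam : k.

(* The power x^[4] plus a binary quartic in y, z whose classical invariants are
   I = lam and J = -1. *)
Definition family_quartic : dpspace 3 k :=
  'X_[mon 4 0 0] + 'X_[mon 0 4 0] + 'X_[mon 0 1 3] + lam *: 'X_[mon 0 0 4].
Local Notation F := family_quartic.

(** The polarization of the quartic as a symmetric 4-linear form; divided powers leave no binomial
    coefficients. *)
Definition family_form u v w z : k :=
  u 0 o0 * v 0 o0 * w 0 o0 * z 0 o0 + u 0 o1 * v 0 o1 * w 0 o1 * z 0 o1
  + (u 0 o1 * v 0 o2 * w 0 o2 * z 0 o2 + u 0 o2 * v 0 o1 * w 0 o2 * z 0 o2
     + u 0 o2 * v 0 o2 * w 0 o1 * z 0 o2 + u 0 o2 * v 0 o2 * w 0 o2 * z 0 o1)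
  + lam * (u 0 o2 * v 0 o2 * w 0 o2 * z 0 o2).

Lemma pairing_family s : pairing s F =
  s (mon 4 0 0) + s (mon 0 4 0) + s (mon 0 1 3) + lam * s (mon 0 0 4).
Proof.
have -> : pairing s F = pairing s ('X_[mon 4 0 0] : dpspace 3 k) + pairing s 'X_[mon 0 4 0]
    + pairing s 'X_[mon 0 1 3] + pairing s (lam *: ('X_[mon 0 0 4] : dpspace 3 k)).
  by rewrite -!pairingDr.
by rewrite linearZ /= !pairingX.
Qed.

Lemma family_formE u v w z :
  pairing (linear_form u * (linear_form v * (linear_form w * linear_form z))) F
  = family_form u v w z.
Proof.
rewrite pairing_family -[linear_form z]mulr1 !coef_linear_formM.
have -> : (1 : S) (mon 0 0 0) = 1.
  by rewrite fps1_coef /mon !mulm0n !add0m eqxx.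
by rewrite /family_form; ring.
Qed.

Lemma family_homog : F \is 4.-homog.
Proof.
by rewrite /family_quartic !dhomogD ?dhomogZ // dhomogX; apply/eqP/mdeg_mon.
Qed.

Definition unit_row (i : 'I_3) : 'rV[k]_3 := \row_j (j == i)%:R.
Local Notation e i := (unit_row i).

Lemma linear_form_unit_row i : linear_form (e i) = X i.
Proof.
apply: fpseriesP => m; rewrite coef_linear_form (bigD1 i) //= mxE eqxx mul1r.
by rewrite big1 ?addr0 // => j /negPf ne; rewrite mxE ne mul0r.
Qed.

Lemma family_neq0 : F != 0.
Proof.
apply/eqP => F0; have := family_formE (e o0) (e o0) (e o0) (e o0).
rewrite F0 linear0 /family_form !mxE /= => /esym/eqP.
by rewrite !mulr1 !mulr0 !addr0 oner_eq0.
Qed.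

Local Notation B := family_form.
Local Notation filt := (apolar_filt family_neq0).

Lemma pairing_ord4 s t : ord_ge 4 t -> pairing (s * t) F = s 0%MM * pairing t F.
Proof.
move=> ot; rewrite -{1}[s](subrK (s 0%MM)%:A) mulrDl pairingDl -scalerAl mul1r.
rewrite (pairing_homog_ord family_homog) ?add0r ?pairingZl //.
by apply: (@ord_geM _ _ 1 4) => //; apply: ord_ge_const.
Qed.

Lemma pairing_ord1 s t : ord_ge 1 s -> ord_ge 3 t ->
  pairing (s * t) F = pairing (linear_form (linear_part s) * t) F.
Proof.
move=> os ot; apply/eqP; rewrite -subr_eq0 -pairingBl -mulrBl.
rewrite (pairing_homog_ord family_homog) //.
by apply: (@ord_geM _ _ 2 3) => //; apply: ord_ge_linear_part.
Qed.

(** The rows [N i] describe the quadratic part of [s] as a sum of [X i] times linear forms; terms of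
    order 3 are invisible against [t]. *)
Lemma pairing_ord2 s : ord_ge 2 s -> exists N : 'I_3 -> 'rV[k]_3, forall t,
  ord_ge 2 t -> pairing (s * t) F = \sum_i pairing (X i * (linear_form (N i) * t)) F.
Proof.
case/ord_geS_split => r or ->; exists (fun i => linear_part (r i)) => t ot.
rewrite mulr_suml pairing_suml; apply: eq_bigr => i _.
apply/eqP; rewrite -subr_eq0 -pairingBl -mulrA -mulrBr -mulrBl.
rewrite (pairing_homog_ord family_homog) //.
apply: (@ord_geM _ _ 1 4); first by apply: ord_ge_Xm_mdeg; rewrite mdeg1.
by apply: (@ord_geM _ _ 2 2) => //; apply: ord_ge_linear_part.
Qed.

Let oX (i : 'I_3) : ord_ge 1 (X i). Proof. by apply: ord_ge_Xm_mdeg; rewrite mdeg1. Qed.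

Lemma family_pairingX i j l m : pairing (X i * (X j * (X l * X m))) F = B (e i) (e j) (e l) (e m).
Proof. by rewrite -family_formE !linear_form_unit_row. Qed.

Let p1 (i : 'I_3) : S := X i.
(** Cubics dual to the variables. The dual of z is taken from [y z^[3]] rather than [z^[4]], which
    keeps [lam] out. *)
Let q1 (i : 'I_3) : S :=
  [:: X o0 * (X o0 * X o0); X o1 * (X o1 * X o1); X o1 * (X o2 * X o2)]`_i.

Let oq1 i : ord_ge 3 (q1 i).
Proof.
have o3 (a b c : 'I_3) : ord_ge 3 (X a * (X b * X c)).
  by apply: (@ord_geM _ _ 1 2) => //; apply: (@ord_geM _ _ 1 1).
by move: i; apply: ord3P; apply: o3.
Qed.

Let p1q1 u i : pairing (linear_form u * q1 i) F = u 0 i.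
Proof.
by move: i; apply: ord3P; rewrite /q1 /= -!linear_form_unit_row family_formE /B !mxE /=; ring.
Qed.

Let dual1 s t : ord_ge 1 s -> ord_ge 3 t ->
  pairing (s * t) F = \sum_l pairing (s * q1 l) F * pairing (p1 l * t) F.
Proof.
move=> os ot; rewrite pairing_ord1 // {1}/linear_form mulr_suml pairing_suml.
apply: eq_bigr => i _.
by rewrite -scalerAl pairingZl pairing_ord1 // p1q1.
Qed.

Lemma family_quotient_dim1 : quotient_dim (filt 1) (filt 2) 3.
Proof.
apply: (@quotient_dim_dual_bases _ _ _ family_neq0 4 1 3 p1 q1 family_homog) => // j l.
by rewrite /p1 -linear_form_unit_row p1q1 mxE eq_sym.
Qed.

Lemma family_quotient_dim3 : quotient_dim (filt 3) (filt 4) 3.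
Proof.
apply: (@quotient_dim_dual_bases _ _ _ family_neq0 4 3 3 q1 p1 family_homog) => // [j l | s t os ot].
  by rewrite mulrC /p1 -linear_form_unit_row p1q1 mxE.
rewrite mulrC dual1 //; apply: eq_bigr => l _.
by rewrite mulrC [s * _]mulrC [t * _]mulrC.
Qed.

(** The monomials xy and xz annihilate the quartic; these are the other four. *)
Let p2 (i : 'I_4) : S :=
  [:: X o0 * X o0; X o1 * X o1; X o1 * X o2; X o2 * X o2]`_i.
(** On y^2, yz, z^2 the pairing is 1 on (y^2, y^2) and (yz, z^2), [lam] on (z^2, z^2) and zero
    otherwise; replacing z^2 by z^2 - [lam] yz removes [lam] and makes the bases dual. *)
Let q2 (i : 'I_4) : S :=
  [:: X o0 * X o0; X o1 * X o1; X o2 * (X o2 - lam *: X o1); X o1 * X o2]`_i.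

Let oX2 (a b : 'I_3) : ord_ge 2 (X a * X b). Proof. exact: (@ord_geM _ _ 1 1). Qed.
Let op2 i : ord_ge 2 (p2 i).
Proof. by rewrite /p2; case: i => -[|[|[|[|i]]]] lt /=. Qed.
Let oq2 i : ord_ge 2 (q2 i).
Proof.
rewrite /q2; case: i => -[|[|[|[|i]]]] lt //=.
by apply: (@ord_geM _ _ 1 1) => //; apply: ord_geB => //; apply: ord_geZ.
Qed.

Let pairing2 (i : 'I_3) u (a b : 'I_3) :
  pairing (X i * (linear_form u * (X a * X b))) F = B (e i) u (e a) (e b).
Proof. by rewrite -!linear_form_unit_row family_formE. Qed.

Let mixed0 (i : 'I_3) t : i != o0 -> ord_ge 2 t -> pairing ((X o0 * X i) * t) F = 0.
Proof.
move=> ne ot; have [N NE] := pairing_ord2 ot.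
rewrite mulrC NE // big1 // => j _; rewrite pairing2 /B !mxE /=.
by rewrite eq_sym in ne; rewrite !(negPf ne) /=; ring.
Qed.

Lemma family_mixed0 (i : 'I_3) t : i != o0 -> pairing ((X o0 * X i) * t) F = 0.
Proof.
move=> ne; apply/eqP; rewrite mulrC; apply/eqP; move: t; apply/annihilatorP.
apply: (homog_annihilator (i := 2) family_homog) => // [|m dm].
  by apply: (@fps_homogM _ _ 1 1); rewrite -linear_form_unit_row; apply: fps_homog_linear_form.
by rewrite mulrC mixed0 //; apply: ord_ge_Xm_mdeg.
Qed.

Lemma family_quotient_dim2 : quotient_dim (filt 2) (filt 3) 4.
Proof.
have S4 (f : 'I_4 -> k) : \sum_i f i = f (@Ordinal 4 0 isT) + f (@Ordinal 4 1 isT)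
    + f (@Ordinal 4 2 isT) + f (@Ordinal 4 3 isT).
  rewrite !big_ord_recl big_ord0 addr0 !addrA.
  by congr (f _ + f _ + f _ + f _); apply: val_inj.
have q2E (g : S -> k) : g (X o2 * (X o2 - lam *: X o1)) = g (X o2 * X o2 - lam *: (X o2 * X o1)).
  by rewrite mulrBr scalerAr.
apply: (@quotient_dim_dual_bases _ _ _ family_neq0 4 2 4 p2 q2 family_homog) => //.
  move=> j l; rewrite /p2 /q2 (q2E (fun x => pairing (_ * [:: _; _; x; _]`_l) F)).
  case: j => -[|[|[|[|j]]]] ltj //; case: l => -[|[|[|[|l]]]] ltl //=;
  by rewrite ?mulrBr ?pairingBl -?scalerAr ?pairingZl -!mulrA
    -!linear_form_unit_row !family_formE /B !mxE /=; ring.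
move=> s t os ot; have [N NE] := pairing_ord2 os.
pose b (i j : 'I_3) := pairing (X i * X j * t) F.
have bC i j : b i j = b j i by rewrite /b [X i * _]mulrC.
have b01 : b o0 o1 = 0 by apply: family_mixed0.
have b02 : b o0 o2 = 0 by apply: family_mixed0.
have -> : pairing (s * t) F = N o0 0 o0 * b o0 o0 + N o1 0 o1 * b o1 o1
    + (N o1 0 o2 + N o2 0 o1) * b o1 o2 + N o2 0 o2 * b o2 o2.
  have row_sum i : pairing (X i * (linear_form (N i) * t)) F = \sum_j N i 0 j * b i j.
    rewrite mulr_suml mulr_sumr pairing_suml; apply: eq_bigr => j _.
    by rewrite -scalerAl -scalerAr pairingZl mulrA.
  rewrite NE // (eq_bigr _ (fun i _ => row_sum i)) !sum_ord3.
  by rewrite (bC o1 o0) (bC o2 o0) (bC o2 o1) b01 b02; ring.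
have sq (x y : 'I_3) : pairing (s * (X x * X y)) F = \sum_i B (e i) (N i) (e x) (e y).
  by rewrite NE //; apply: eq_bigr => i _; rewrite pairing2.
have -> : \sum_l pairing (s * q2 l) F * pairing (p2 l * t) F
    = N o0 0 o0 * b o0 o0 + N o1 0 o1 * b o1 o1
    + (N o1 0 o2 + N o2 0 o1) * b o1 o2 + N o2 0 o2 * b o2 o2.
  rewrite S4 /p2 /q2 (q2E (fun x => pairing (s * [:: _; _; x; _]`_2) F)) /=.
  rewrite mulrBr pairingBl -scalerAr pairingZl !sq !sum_ord3 /B !mxE /=.
  by congr (_ * _ + _ * _ + _ * _ + _ * _); ring.
by [].
Qed.

Lemma family_hilbert_function :
  has_hilbert_function (Apolar family_neq0) (nth 0%N [:: 1; 3; 4; 3; 1]%N).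
Proof.
have X4 : pairing (X o0 * (X o0 * (X o0 * X o0))) F = 1.
  by rewrite -!linear_form_unit_row family_formE /B !mxE /=; ring.
have oX4 : ord_ge 4 (X o0 * (X o0 * (X o0 * X o0))).
  by apply: (@ord_geM _ _ 1 3) => //; apply: (@ord_geM _ _ 1 2) => //.
apply/has_hilbert_functionP => -[|[|[|[|[|i]]]]] /=.
- apply: (@quotient_dim_dual_bases _ _ _ family_neq0 4 0 1 (fun=> 1)
    (fun=> X o0 * (X o0 * (X o0 * X o0))) family_homog) => // [j l | s t _ ot].
    by rewrite /= mul1r X4 !ord1.
  by rewrite big_ord1 /= mul1r (pairing_ord4 s ot) (pairing_ord4 s oX4) X4 mulr1.
- exact: family_quotient_dim1.
- exact: family_quotient_dim2.
- exact: family_quotient_dim3.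
- apply: (@quotient_dim_dual_bases _ _ _ family_neq0 4 4 1
    (fun=> X o0 * (X o0 * (X o0 * X o0))) (fun=> 1) family_homog) => // [j l | s t os _].
    by rewrite /= mulr1 X4 !ord1.
  rewrite big_ord1 /= mulr1 [s * t]mulrC [_ * t]mulrC (pairing_ord4 t os) (pairing_ord4 t oX4) X4 mulr1.
  exact: mulrC.
(* Above degree 4 the filtration is zero, in accordance with the default value of [nth]. *)
have zero j x : (4 < j)%N -> x \in filt j -> x = 0.
  move=> lt /apolar_filtP[s os ->]; apply/apolar_pi_eq0 => t.
  by apply: (pairing_homog_ord family_homog); apply/ord_geMl/(ord_geW lt).
rewrite nth_nil; exists (fun j : 'I_0 => 0); split; first by case.
move=> v /zero -> //; exists 0; split => [|c _]; last by apply/rowP => -[].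
by rewrite big_ord0 subr0; apply/apolar_filtP; exists 0 => //; rewrite apolar_pi0.
Qed.

End QuarticFamily.

(** * Isomorphisms within the family *)

Section Isomorphisms.
Variable k : fieldType.
Local Notation X i := (fpsXm k U_(i)%MM).
Local Notation e i := (unit_row k i).

(* The images [u], [v], [w] of the variables satisfy uv = uw = 0, which forces [u]
   to be a multiple of x and [v], [w] to involve only y and z; then lam and lam'
   are compared through the invariants I and J of the binary quartics. *)
Lemma family_form_rigid (lam lam' c : k) (l : 'I_3 -> 'rV[k]_3) : c != 0 ->
    (forall i j r s, family_form lam' (l i) (l j) (l r) (l s)
       = c * family_form lam (e i) (e j) (e r) (e s)) ->
    (forall a b, family_form lam' a b (l o0) (l o1) = 0) ->
    (forall a b, family_form lam' a b (l o0) (l o2) = 0) ->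
  lam ^+ 3 = lam' ^+ 3.
Proof.
move=> c0 H H1 H2; set u := l o0; set v := l o1; set w := l o2.
(* That the product of [u] and [x] annihilates the quartic is read off on unit vectors; the third
   relation clears the [lam'] term from the fourth. *)
have ann x : (forall a b, family_form lam' a b u x = 0) ->
    [/\ u 0 o0 * x 0 o0 = 0, u 0 o1 * x 0 o1 = 0, u 0 o2 * x 0 o2 = 0
      & u 0 o1 * x 0 o2 + u 0 o2 * x 0 o1 = 0].
  move=> Hx; have E00 := Hx (e o0) (e o0); have E11 := Hx (e o1) (e o1).
  have E12 := Hx (e o1) (e o2); have E22 := Hx (e o2) (e o2).
  move: E00 E11 E12 E22; rewrite /family_form !mxE /=.
  rewrite !(mul0r, mulr0, mul1r, addr0, add0r) => E00 E11 E12.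
  by rewrite E12 mulr0 addr0; split.
have [uv0 uv1 uv2 uv12] := ann v H1; have [uw0 uw1 uw2 uw12] := ann w H2.
have value (a b r s : 'I_3) (y : k) : family_form lam (e a) (e b) (e r) (e s) = y ->
    family_form lam' (l a) (l b) (l r) (l s) = c * y by move=> <-; apply: H.
have H0000 : family_form lam' u u u u = c * 1.
  by apply: value; rewrite /family_form !mxE /=; ring.
have H1111 : family_form lam' v v v v = c * 1.
  by apply: value; rewrite /family_form !mxE /=; ring.
have H1112 : family_form lam' v v v w = c * 0.
  by apply: value; rewrite /family_form !mxE /=; ring.
have H1122 : family_form lam' v v w w = c * 0.
  by apply: value; rewrite /family_form !mxE /=; ring.
have H1222 : family_form lam' v w w w = c * 1.
  by apply: value; rewrite /family_form !mxE /=; ring.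
have H2222 : family_form lam' w w w w = c * lam.
  by apply: value; rewrite /family_form !mxE /=; ring.
move: H0000 H1111 H1112 H1122 H1222 H2222; rewrite /family_form !mulr1 !mulr0.
move=> H0000 H1111 H1112 H1122 H1222 H2222.
have cancel0 (x y : k) : x != 0 -> x * y = 0 -> y = 0.
  by move=> x0 /eqP; rewrite mulf_eq0 (negPf x0) => /eqP.
(* If both vectors were on the first axis, the values on v^4 and v w^3 would make both nonzero,
   while the value on v^2 w^2 is zero. *)
have not_axis : ~ [/\ v 0 o1 = 0, v 0 o2 = 0, w 0 o1 = 0 & w 0 o2 = 0].
  move=> [v1 v2 w1 w2]; move: H1111 H1122 H1222.
  rewrite v1 v2 w1 w2 !(mul0r, mulr0, addr0) => E1 E2 E3.
  have v0 : v 0 o0 != 0 by apply: contraNneq c0 => z; rewrite -E1 z !mul0r.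
  have w0 : w 0 o0 != 0 by apply: contraNneq c0 => z; rewrite -E3 z !mulr0.
  by move/eqP: E2; rewrite !mulf_eq0 (negPf v0) (negPf w0).
have u1 : u 0 o1 = 0.
  apply/eqP/negPn/negP => nz; apply: not_axis.
  have v1 := cancel0 _ _ nz uv1; have w1 := cancel0 _ _ nz uw1.
  rewrite v1 mulr0 addr0 in uv12; rewrite w1 mulr0 addr0 in uw12.
  by split=> //; [apply: cancel0 nz uv12 | apply: cancel0 nz uw12].
have u2 : u 0 o2 = 0.
  apply/eqP/negPn/negP => nz; apply: not_axis.
  have v2 := cancel0 _ _ nz uv2; have w2 := cancel0 _ _ nz uw2.
  rewrite v2 mulr0 add0r in uv12; rewrite w2 mulr0 add0r in uw12.
  by split=> //; [apply: cancel0 nz uv12 | apply: cancel0 nz uw12].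
have u0 : u 0 o0 != 0.
  by apply: contraNneq c0 => z; rewrite -H0000 z u1 u2; apply/eqP; ring.
have v0 := cancel0 _ _ u0 uv0; have w0 := cancel0 _ _ u0 uw0.
move: H1111 H1112 H1122 H1222 H2222; rewrite v0 w0.
set p := v 0 o1; set q := v 0 o2; set r := w 0 o1; set s := w 0 o2.
set g0 := (X in X = _ -> _) => E0; set g1 := (X in X = _ -> _) => E1.
set g2 := (X in X = _ -> _) => E2; set g3 := (X in X = _ -> _) => E3.
set g4 := (X in X = _ -> _) => E4.
(* [D] is the determinant of the substitution in y, z. [EI] and [EJ] are the transformation laws of
   I and J for the binary quartic with coefficients [g0] to [g4]. *)
pose D := p * s - q * r.
have EI : g0 * g4 - 4%:R * g1 * g3 + 3%:R * g2 ^+ 2 = D ^+ 4 * lam'.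
  by rewrite /g0 /g1 /g2 /g3 /g4 /D; ring.
have EJ : g0 * g2 * g4 + 2%:R * g1 * g2 * g3 - g0 * g3 ^+ 2 - g1 ^+ 2 * g4 - g2 ^+ 3
    = - D ^+ 6 by rewrite /g0 /g1 /g2 /g3 /g4 /D; ring.
rewrite E0 E1 E2 E3 E4 in EI EJ.
have {}EI : c ^+ 2 * lam = D ^+ 4 * lam' by rewrite -EI; ring.
have {}EJ : c ^+ 3 = D ^+ 6 by apply: oppr_inj; rewrite -EJ; ring.
(* Cubing the law of I leaves [D ^+ 12] on one side, which is [c ^+ 6] by the law of J. *)
apply: (mulfI (expf_neq0 6 c0)); transitivity ((c ^+ 2 * lam) ^+ 3); first by ring.
have -> : c ^+ 6 = D ^+ 6 * D ^+ 6 by rewrite -EJ; ring.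
by rewrite EI; ring.
Qed.

Lemma family_pi_top lam s : ord_ge 4 s -> pairing s (family_quartic lam) = 0 ->
  @apolar_pi 3 k (family_quartic lam) (family_neq0 lam) s = 0.
Proof.
by move=> os s0; apply/apolar_pi_eq0 => t; rewrite pairing_ord4 // s0 mulr0.
Qed.

Lemma pairing_linear_parts lam (t1 t2 t3 t4 : fpseries 3 k) :
    ord_ge 1 t1 -> ord_ge 1 t2 -> ord_ge 1 t3 -> ord_ge 1 t4 ->
  pairing (t1 * (t2 * (t3 * t4))) (family_quartic lam) =
  family_form lam (linear_part t1) (linear_part t2) (linear_part t3) (linear_part t4).
Proof.
move=> o1 o2 o3 o4; rewrite -family_formE; apply/eqP; rewrite -subr_eq0 -pairingBl.
rewrite (pairing_homog_ord (family_homog lam)) //.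
have d1 := ord_ge_linear_part o1; have d2 := ord_ge_linear_part o2.
have d3 := ord_ge_linear_part o3; have d4 := ord_ge_linear_part o4.
have l1 := ord_ge_linear_form (linear_part t1); have l2 := ord_ge_linear_form (linear_part t2).
have l3 := ord_ge_linear_form (linear_part t3).
move: d1 d2 d3 d4 l1 l2 l3; set a1 := linear_form _; set a2 := linear_form _.
set a3 := linear_form _; set a4 := linear_form _ => d1 d2 d3 d4 l1 l2 l3.
have -> : t1 * (t2 * (t3 * t4)) - a1 * (a2 * (a3 * a4)) =
    (t1 - a1) * (t2 * (t3 * t4)) + a1 * ((t2 - a2) * (t3 * t4)
      + a2 * ((t3 - a3) * t4 + a3 * (t4 - a4))) by ring.
have m d e' := @ord_geM 3 k d e'.
apply: ord_geD; first by apply: (m 2 3) => //; apply: (m 1 2) => //; apply: (m 1 1).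
apply: (m 1 4) => //; apply: ord_geD; first by apply: (m 2 2) => //; apply: (m 1 1).
by apply: (m 1 3) => //; apply: ord_geD; [apply: (m 2 1) | apply: (m 1 2)].
Qed.

(** No lift of [phi] to an automorphism of power series is needed: representatives [t i] of the
    images of the variables suffice, as products of four of them pair with the quartic through their
    linear parts. *)
Lemma family_isomorphic (lam lam' : k) :
    alg_isomorphic (Apolar (family_neq0 lam)) (Apolar (family_neq0 lam')) ->
  lam ^+ 3 = lam' ^+ 3.
Proof.
move=> [phi bphi]; set p := @apolar_pi 3 k (family_quartic lam) (family_neq0 lam).
set p' := @apolar_pi 3 k (family_quartic lam') (family_neq0 lam').
have /choice[t tE] i : exists t, phi (p (X i)) = p' t.
  by have [t ->] := apolar_pi_surj (phi (p (X i))); exists t.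
have oX (i : 'I_3) : ord_ge 1 (X i) by apply: ord_ge_Xm_mdeg; rewrite mdeg1.
have ot i : ord_ge 1 (t i).
  apply/ord_ge1P/eqP/negPn/negP => /fps_unit[r rt].
  (* The class of [X i] is nilpotent; if [t i] were a unit, 1 would be nilpotent in the target. *)
  have X5 : p (X i ^+ 5) = 0.
    apply/apolar_pi_eq0 => s; apply: (pairing_homog_ord (family_homog lam)).
    exact/ord_geMl/ord_geX.
  have : p' (t i ^+ 5) = 0.
    by rewrite /p' apolar_piX -/p' -tE -rmorphXn -apolar_piX -/p X5 rmorph0.
  move=> t5; have /eqP : p' ((r * t i) ^+ 5) = 0.
    by rewrite exprMn /p' apolar_piM -/p' t5 mulr0.
  by rewrite rt expr1n /p' apolar_pi1 oner_eq0.
have phiM x y : phi (x * y) = phi x * phi y by exact: rmorphM.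
have phi2 i j : phi (p (X i * X j)) = p' (t i * t j).
  by rewrite /p apolar_piM phiM -/p !tE -apolar_piM.
pose X4 (i j r s : 'I_3) : fpseries 3 k := X i * (X j * (X r * X s)).
pose t4 (i j r s : 'I_3) : fpseries 3 k := t i * (t j * (t r * t s)).
have phi4 i j r s : phi (p (X4 i j r s)) = p' (t4 i j r s).
  by rewrite /p !apolar_piM !phiM -/p !tE -!apolar_piM.
have o4 (x1 x2 x3 x4 : fpseries 3 k) : ord_ge 1 x1 -> ord_ge 1 x2 -> ord_ge 1 x3 ->
    ord_ge 1 x4 -> ord_ge 4 (x1 * (x2 * (x3 * x4))).
  move=> *; apply: (@ord_geM 3 k 1 3) => //; apply: (@ord_geM 3 k 1 2) => //.
  exact: (@ord_geM 3 k 1 1).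
have X4E i j r s : pairing (X4 i j r s) (family_quartic lam)
    = family_form lam (e i) (e j) (e r) (e s) by apply: family_pairingX.
have X0E : family_form lam (e o0) (e o0) (e o0) (e o0) = 1.
  by rewrite /family_form !mxE /=; ring.
(* The scalar by which [phi] acts on the line m^4, measured on x^4, which pairs to 1 with the source
   quartic. *)
pose c := pairing (t4 o0 o0 o0 o0) (family_quartic lam').
have piX4 i j r s : p (X4 i j r s)
    = family_form lam (e i) (e j) (e r) (e s) *: p (X4 o0 o0 o0 o0).
  apply/eqP; rewrite -subr_eq0 /p -apolar_piZ -apolar_piB family_pi_top //.
    by apply: ord_geB; [|apply: ord_geZ]; apply: o4.
  by rewrite pairingBl pairingZl !X4E X0E mulr1 subrr.
(* The classes of xy and xz are zero in the source algebra, hence so are their images. *)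
have annE (j : 'I_3) : j != o0 -> forall a b,
    family_form lam' a b (linear_part (t o0)) (linear_part (t j)) = 0.
  move=> ne a b; have : p' (t o0 * t j) = 0.
    rewrite -phi2 (_ : p _ = 0) ?rmorph0 //; apply/apolar_pi_eq0 => s.
    by rewrite mulrC family_mixed0.
  move/apolar_pi_eq0/(_ (linear_form a * linear_form b)).
  have lE x : linear_part (linear_form x) = x :> 'rV[k]_3.
    by apply/rowP => i; rewrite mxE linear_formU.
  by rewrite -mulrA pairing_linear_parts ?lE //; apply: ord_ge_linear_form.
apply: (@family_form_rigid lam lam' c (fun i => linear_part (t i))).
- apply/eqP => c0; have : phi (p (X4 o0 o0 o0 o0)) = 0.
    by rewrite phi4 /p' family_pi_top //; apply: o4.
  rewrite -(rmorph0 phi) => /(bij_inj bphi)/apolar_pi_eq0/(_ 1).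
  by rewrite mul1r X4E X0E => /eqP; rewrite oner_eq0.
- move=> i j r s; rewrite -pairing_linear_parts // -/(t4 i j r s).
  have : p' (t4 i j r s - family_form lam (e i) (e j) (e r) (e s) *: t4 o0 o0 o0 o0) = 0.
    rewrite /p' apolar_piB apolar_piZ -/p' -!phi4 piX4 linearZ_LR subrr //.
  move/apolar_pi_eq0/(_ 1); rewrite mul1r pairingBl pairingZl -/c => /eqP.
  by rewrite subr_eq0 mulrC => /eqP.
- exact: (annE o1).
- exact: (annE o2).
Qed.

End Isomorphisms.

(** * Facts on the base field and conclusion *)

Lemma natr_neq0_of_pchar (R : fieldType) (N n : nat) :
    (forall p : nat, p \in [pchar R] -> (N < p)%N) -> (0 < n <= N)%N ->
  (n%:R : R) != 0.
Proof.
move=> large /andP[n0 nN]; apply/negP => n_eq0; have [p pR] := natf0_pchar n0 n_eq0.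
have /(dvdn_leq n0) pn : (p %| n)%N by rewrite (dvdn_pcharf pR).
by have := large p pR; rewrite ltnNge (leq_trans pn nN).
Qed.

(** A greedy choice: [s n] lists the first [n] values, and a non-root of the monic polynomial with
    these roots is the next one. *)
Lemma closed_field_injection (k : closedFieldType) :
  exists g : nat -> k, injective g.
Proof.
have fresh (s : seq k) : exists x, x \notin s.
  have : \prod_(a <- s) ('X - a%:P) != 0 by apply/monic_neq0/monic_prod_XsubC.
  by move/closed_nonrootP => [x]; rewrite root_prod_XsubC; exists x.
have [f fP] := choice fresh; pose s := fix s n := if n is m.+1 then f (s m) :: s m else [::].
exists (fun n => f (s n)) => i j eqf; apply/eqP/negPn/negP.
have memf a b : (a < b)%N -> f (s a) \in s b.
  elim: b => // b IH; rewrite ltnS leq_eqVlt inE.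
  by case/orP => [/eqP -> | /IH ->]; rewrite ?eqxx ?orbT.
rewrite neq_ltn => /orP[] /memf; first by rewrite eqf (negPf (fP _)).
by rewrite -eqf (negPf (fP _)).
Qed.

Theorem mainTheorem8 (k : closedFieldType)
    (char_k : forall p : nat, p \in [pchar k] -> (4 < p)%N) :
  (exists A : nat -> comAlgType k,
     (forall i, local_artinian_gorenstein (A i) /\
        has_hilbert_function (A i) (nth 0%N [:: 1; 3; 4; 3; 1]%N)) /\
     (forall i j, i <> j -> ~ alg_isomorphic (A i) (A j)))
  /\
  (forall (F : dpspace 3 k) (F0 : F != 0),
     F \is 4.-homog ->
     has_hilbert_function (Apolar F0) (nth 0%N [:: 1; 3; 4; 3; 1]%N) ->
     (forall C : dpspace 3 k, (msize C <= 4)%N -> G_orbit F (F + C))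
     <->
     (forall c : 'rV[k]_3, c != 0 -> contract (linear_form c ^+ 2) F != 0)).
Proof.
split.
  have [g ginj] := closed_field_injection k.
  (* Isomorphic members have equal [lam ^+ 3], so cube roots of distinct elements are taken as
     parameters. *)
  have [lam lamE] := choice (fun i => closed_root_exists (g i) (isT : 0 < 3)%N).
  exists (fun i => Apolar (family_neq0 (lam i))); split=> [i | i j ne].
    split; first exact: apolar_local_artinian_gorenstein.
    exact: family_hilbert_function.
  by move/family_isomorphic; rewrite !lamE => /ginj.
move=> F F0 hF /has_hilbert_functionP HF.
split; first exact: orbit_square_free.
move=> sqf C; apply: (square_free_orbit hF (HF 1%N) (HF 2%N)) => //.
  exact: natr_neq0_of_pchar char_k _.
exact: natr_neq0_of_pchar char_k _.
Qed.
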